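(* Let $n,N\ge 1$ be integers and let $1<p<p_{sg}$. Let $f=(f_1,\dots,f_N):K\to\mathbb{R}^N$ satisfy $f=\nabla F$, where $F\in C^{1+\alpha}_{loc}(K,\mathbb{R})$ for some $\alpha>0$ and $F(0)=0$. Let $q\in[0,p]$, and if $q<p-1$ assume in addition that $p<1+\frac2n(q+1)$. Assume that for any $D>0$ there exist $C_D,c_D>0$ and $\xi=(\xi_1,\dots,\xi_N)\in(0,\infty)^N$ such that $$|f(U)|\le C_D|U|^q\quad\text{and}\quad \xi\cdot f(U)\ge c_D|U|^p\quad\text{for all } U\in K,\ |U|\le D.$$ Finally assume that the problem $-\Delta U=f(U)$ in $\mathbb{R}^n$ does not possess nontrivial classical bounded solutions in $\mathcal{K}$. Then the system $$U_t-\Delta U=f(U)\quad\text{in }\mathbb{R}^n\times\mathbb{R}$$ does not possess any nontrivial classical bounded solution satisfying $U(\cdot,t)\in\mathcal{K}$ for all $t\in\mathbb{R}$.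
   Context: $p_{sg}:=\frac{n}{n-2}$ if $n\ge3$ and $p_{sg}:=\infty$ if $n\in\{1,2\}$. $K:=\{U=(u_1,\dots,u_N)\in\mathbb{R}^N: u_i\ge0,\ i=1,\dots,N\}$ and $\mathcal{K}:=\{U=(u_1,\dots,u_N)\in C^2(\mathbb{R}^n,\mathbb{R}^N): u_i\ge0,\ i=1,\dots,N\}$. $|\cdot|$ is the Euclidean norm. A nontrivial solution is a classical solution $U=(u_1,\dots,u_N)\not\equiv(0,\dots,0)$. $U_t$ denotes $\partial U/\partial t$, and $\Delta$ acts componentwise in the space variable $x\in\mathbb{R}^n$. $F\in C^{1+\alpha}_{loc}(K,\mathbb{R})$ means that $F$ is $C^1$ on $K$ (up to the boundary) with locally $\alpha$-Hölder continuous gradient. *)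

(* Defs.v *)
From mathcomp Require Import all_boot all_order all_algebra.
From mathcomp Require Import all_classical all_reals all_analysis.

Set Implicit Arguments.
Unset Strict Implicit.
Unset Printing Implicit Defensive.

Import Order.TTheory GRing.Theory Num.Theory.
Import numFieldNormedType.Exports.

Local Open Scope classical_set_scope.
Local Open Scope ring_scope.

Definition dotv (R : realType) (m : nat) (u v : 'rV[R]_m) : R :=
  \sum_(i < m) u 0 i * v 0 i.

(* The library norm `|u| on 'rV[R]_m is the sup norm. *)
Definition enorm (R : realType) (m : nat) (u : 'rV[R]_m) : R :=
  Num.sqrt (dotv u u).

Definition p_sg (R : realType) (n : nat) : \bar R :=
  if (n <= 2)%N then +oo%E else (n%:R / (n%:R - 2))%:E.

Definition coneK (R : realType) (N : nat) : set 'rV[R]_N :=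
  [set U | forall i, 0 <= U 0 i].

(* F is differentiable at every point U of A relative to A, with gradient g U.
   On a set such as coneK this covers boundary points (one-sided derivatives),
   and g is uniquely determined on A.  Values of F and g off A are irrelevant. *)
Definition gradient_on (R : realType) (N : nat) (A : set 'rV[R]_N)
    (F : 'rV[R]_N -> R) (g : 'rV[R]_N -> 'rV[R]_N) : Prop :=
  forall U, A U -> forall e : R, 0 < e ->
    \forall V \near within A (nbhs U),
      `|F V - F U - dotv (g U) (V - U)| <= e * enorm (V - U).

(* Hoelder continuity on bounded parts of A; for the closed set coneK this is
   Hoelder continuity on compact subsets. *)
Definition loc_hoelder_on (R : realType) (N : nat) (A : set 'rV[R]_N)
    (alpha : R) (g : 'rV[R]_N -> 'rV[R]_N) : Prop :=
  forall D : R, 0 < D -> exists L : R, forall U V, A U -> A V ->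
    enorm U <= D -> enorm V <= D ->
    enorm (g U - g V) <= L * enorm (U - V) `^ alpha.

Definition C1alpha_loc_on (R : realType) (N : nat) (A : set 'rV[R]_N)
    (alpha : R) (F : 'rV[R]_N -> R) : Prop :=
  exists g : 'rV[R]_N -> 'rV[R]_N,
    [/\ gradient_on A F g, {within A, continuous g} & loc_hoelder_on A alpha g].

Section Space.
Variables (R : realType) (n : nat) (V : normedModType R).
Implicit Types u : 'rV[R]_n -> V.

Definition basis_vec (i : 'I_n) : 'rV[R]_n := delta_mx 0 i.

Definition partial (i : 'I_n) u : 'rV[R]_n -> V := 'D_(basis_vec i) u.

(* All partial derivatives of order at most k exist and are continuous. *)
Fixpoint Ck (k : nat) u : Prop :=
  continuous u /\
  if k is k'.+1 then
    forall i, (forall x, derivable u x (basis_vec i)) /\ Ck k' (partial i u)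
  else True.

Definition laplacian u (x : 'rV[R]_n) : V :=
  \sum_(i < n) partial i (partial i u) x.

Definition dt (U : 'rV[R]_n * R -> V) (z : 'rV[R]_n * R) : V :=
  derive1 (fun s : R => U (z.1, s)) z.2.

Definition slice (U : 'rV[R]_n * R -> V) (t : R) : 'rV[R]_n -> V :=
  fun x => U (x, t).

(* U, U_t and the space derivatives of U of order at most 2 exist and are
   jointly continuous on R^n x R. *)
Definition C21 (U : 'rV[R]_n * R -> V) : Prop :=
  [/\ continuous U,
      (forall x t, derivable (fun s : R => U (x, s)) t 1) /\ continuous (dt U),
      forall t, Ck 2 (slice U t),
      forall i, continuous (fun z => partial i (slice U z.2) z.1)
    & forall i j, continuous (fun z => partial i (partial j (slice U z.2)) z.1)].

End Space.

Definition calK (R : realType) (n N : nat) : set ('rV[R]_n -> 'rV[R]_N) :=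
  [set U | Ck 2 U /\ forall x, coneK (U x)].

Definition elliptic_solution (R : realType) (n N : nat)
    (f : 'rV[R]_N -> 'rV[R]_N) (U : 'rV[R]_n -> 'rV[R]_N) : Prop :=
  Ck 2 U /\ forall x, - laplacian U x = f (U x).

Definition parabolic_solution (R : realType) (n N : nat)
    (f : 'rV[R]_N -> 'rV[R]_N) (U : 'rV[R]_n * R -> 'rV[R]_N) : Prop :=
  C21 U /\ forall x t, dt U (x, t) - laplacian (slice U t) x = f (U (x, t)).

Definition bounded_map (R : realType) (T : Type) (N : nat)
    (U : T -> 'rV[R]_N) : Prop :=
  exists M : R, forall z, enorm (U z) <= M.

Definition nontrivial (R : realType) (T : Type) (N : nat)
    (U : T -> 'rV[R]_N) : Prop :=
  exists z, U z <> 0.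

(* Main.v *)
(* Let r > 0, b := 1 / (p - 1) and let U be a bounded solution.  Testing the
   equation with xi times a cut-off of the box |x| <= r, |t| <= r^2 bounds the
   average of |U|^p over the box by C r^(-2bp).  The gradient structure gives the
   local energy inequality
     avg |U_t|^2 <= C r^-2 (avg |U.f(U)| + avg |F(U)| + r^-2 avg |U|^2),
   where |F(U)| + |U.f(U)| <= C |U|^(q+1).  Hence the integral of |U_t|^2 over
   the box is at most C (r^(n - 2b min(p,q+1)) + r^(n - 2 - 2b)); both exponents
   are negative exactly under the assumptions on p and q, so U_t = 0 and every
   time slice of U solves the elliptic problem.
   Integrals are replaced by averages over finer and finer lattices, and
   integration by parts by the shift invariance of these averages, up to errors
   tending to 0 with the mesh. *)

Require Import Defs.
From mathcomp Require Import all_boot all_order all_algebra.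
From mathcomp Require Import all_classical all_reals all_analysis.
From mathcomp Require Import ring lra.

Set Implicit Arguments.
Unset Strict Implicit.
Unset Printing Implicit Defensive.

Import Order.TTheory GRing.Theory Num.Theory.
Import numFieldNormedType.Exports.

Local Open Scope classical_set_scope.
Local Open Scope ring_scope.

(** * Directional derivatives in space-time and locally uniform convergence *)

(** Averages are never shown to converge to integrals; only combinations of them that tend to 0
    ([null]) are used. Each integral identity becomes an error sequence, each estimate a pointwise
    inequality summed over the lattice. The error depends on the box, so the mesh tends to 0 for a
    fixed box before [r] grows. The weight is a power of the positive part of a quadratic
    polynomial: it vanishes on the faces of the box and has explicit derivatives. A finite power
    suffices once its exponent is large compared with [2 / (p - 1)], so that the term created by two
    derivatives can be absorbed. The delicate point is testing with [U_t]. [C21] gives no mixed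
    space-time derivatives, so the identity is proved exactly for finite differences, which are
    replaced by derivatives only afterwards. [F] is differentiable only relative to the cone, so the
    chain rule for [F(U)] rests on [U] staying there. For the contradiction, a nonzero value of
    [U_t] keeps the weighted average of [|U_t|^2] above a constant times [r^-(n+2)], uniformly in
    the mesh. *)

Lemma cvg_fsum (R : realType) (T : Type) (F : set_system T) (FF : Filter F)
    (I : finType) (f : I -> T -> R) (a : I -> R) :
  (forall i, f i x @[x --> F] --> a i) ->
  (\sum_i f i x) @[x --> F] --> \sum_i a i.
Proof. by move=> H; apply: cvg_big => [|i _]; [exact: add_continuous|exact: H]. Qed.

Section Calculus.
Variables (R : realType) (n : nat).
Local Notation E := ('rV[R]_n * R)%type.
Local Notation dir := (option 'I_n).
Implicit Types (g h : E -> R) (z : E) (d : dir).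

(* [None] is the time direction. *)
Definition dvec d : E := if d is Some i then (delta_mx 0 i, 0) else (0, 1).

(** Only derivatives along lines are recorded, together with joint continuity. This is what [C21]
    provides and what the mean value theorem consumes. *)
Definition has_deriv d g g' := [/\ continuous g, continuous g' &
  forall z s, is_derive s (1 : R) (fun s => g (z + s *: dvec d))
                        (g' (z + s *: dvec d))].

Lemma norm_pair z : `|z| = Num.max `|z.1| `|z.2|.
Proof. by []. Qed.

Lemma norm_dvec d : `|dvec d| <= 1.
Proof.
rewrite norm_pair; case: d => [i|] /=; rewrite  ge_max ?normr0 ?normr1 ?ler01 ?lexx ?andbT //.
rewrite [leLHS]/Num.Def.normr/= mx_normrE bigmax_le ?ler01 // => -[a b] _ /=.
by rewrite mxE; case: (_ && _); rewrite ?normr1 ?normr0 ?ler01.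
Qed.

Lemma compact_ball0 (rho : R) : compact [set z : E | `|z| <= rho].
Proof.
have cI : compact (`[- rho, rho]%classic : set R) by exact: segment_compact.
apply: (@subclosed_compact _ _
   ([set x : 'rV[R]_n | forall i, `[- rho, rho]%classic (x 0 i)] `*` `[- rho, rho]%classic)).
- have cn : continuous (fun z : E => `|z|) by exact: norm_continuous.
  apply: (@closed_comp _ _ (fun z : E => `|z|) [set y | y <= rho]).
    by move=> x _; exact: cn.
  exact: closed_le.
- by apply: compact_setX => //; exact: (@rV_compact _ n (fun=> `[- rho, rho]%classic) (fun=> cI)).
- move=> [x t]; rewrite /= norm_pair /= ge_max => /andP[hx ht].
  split => /=; last by rewrite in_itv /= -ler_norml.
  move=> i; rewrite in_itv /= -ler_norml; apply: le_trans hx.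
  rewrite [leRHS]/Num.Def.normr/= mx_normrE.
  exact: (le_bigmax _ (fun ij : 'I_1 * 'I_n => `|x ij.1 ij.2|) (0, i)).
Qed.

(** Heine's theorem in covering form. Only [z] is confined to the ball: [z'] will be a lattice point
    shifted by one mesh step, which may leave it. *)
Lemma unif_cont g (rho e : R) : continuous g -> 0 < e ->
  exists2 dl, 0 < dl & forall z z', `|z| <= rho -> `|z - z'| < dl ->
    `|g z - g z'| < e.
Proof.
move=> cg e0.
pose P (dl : R) (z : E) := forall z', `|z - z'| < dl -> `|g z - g z'| < e.
have /compact_near_coveringP/(_ R (0 : R)^'+ P _) := @compact_ball0 rho.
case.
  move=> z _.
  have /cvgrPdist_lt /(_ (e / 2)) := cg z.
  rewrite divr_gt0 // => /(_ isT) /nbhs_normP[dl /= dl0 H].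
  exists (ball z (dl / 2), [set x | x < dl / 2]) => /=.
    split; first by apply: nbhsx_ballx; rewrite divr_gt0.
    by apply: nbhs_right_lt; rewrite divr_gt0.
  move=> [z1 d1] /= [b1 b2] z' zz'.
  have b1' : `|z - z1| < dl / 2 by move: b1; rewrite -ball_normE.
  have h1 := H z1; have h2 := H z'.
  rewrite -(subrKA (g z)) (splitr e); apply: (le_lt_trans (ler_normD _ _)).
  apply: ltrD; first by rewrite distrC; apply: h1 => /=; lra.
  apply: h2 => /=; rewrite -(subrKA z1); apply: (le_lt_trans (ler_normD _ _)).
  by rewrite (splitr dl); apply: ltrD => //; apply: lt_trans b2.
move=> dl /= dl0 H.
exists (dl / 2); first by rewrite divr_gt0.
by move=> z z' hz hzz'; apply: (H (dl / 2)) => //=;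
 rewrite ?sub0r ?normrN ?gtr0_norm; lra.
Qed.

Lemma cont_bounded g (rho : R) : continuous g ->
  exists2 M, 0 < M & forall z, `|z| <= rho -> `|g z| <= M.
Proof.
move=> cg; have [M [_ HM]] : bounded_set (g @` [set z : E | `|z| <= rho]).
  apply: compact_bounded; apply: continuous_compact (@compact_ball0 rho).
  exact: continuous_subspaceT.
exists (`|M| + 1); first by rewrite ltr_pwDr.
move=> z hz; apply: (HM (`|M| + 1)); first by rewrite ltr_pwDr ?ler_norm.
by exists z.
Qed.

Lemma has_deriv_mvt d g g' z (h : R) : has_deriv d g g' -> 0 < h ->
  exists2 th, 0 < th < h & g (z + h *: dvec d) - g z = h * g' (z + th *: dvec d).
Proof.
case=> _ _ D h0.
pose G s := g (z + s *: dvec d); pose dG s := g' (z + s *: dvec d).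
have DG s : is_derive s (1 : R) G (dG s) by exact: D.
have cG : {within `[0, h], continuous G}.
  by apply: derivable_within_continuous => y _; exact: (@ex_derive _ _ _ _ _ _ _ (DG y)).
have [c] := MVT h0 (fun x _ => DG x) cG.
rewrite in_itv /= /G /dG => ch; rewrite scale0r addr0 => ->.
by exists c => //; rewrite subr0 mulrC.
Qed.

(** All lattices of a given box lie in one ball, so this mode of convergence is enough to exchange
    difference quotients for derivatives inside averages. *)
Definition loc_unif_cvg (G : nat -> E -> R) g := forall rho e : R, 0 < e ->
  \forall k \near \oo, forall z, `|z| <= rho -> `|G k z - g z| <= e.

Lemma loc_unif_cvg_cst g : loc_unif_cvg (fun=> g) g.
Proof. by move=> rho e e0; near=> k => z _; rewrite subrr normr0 ltW. Unshelve. all: by end_near. Qed.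

Lemma loc_unif_cvgD G H g h : loc_unif_cvg G g -> loc_unif_cvg H h -> 
  loc_unif_cvg (fun k z => G k z + H k z) (fun z => g z + h z).
Proof.
move=> cG cH rho e e0; have e2 : 0 < e / 2 by rewrite divr_gt0.
near=> k.
have a1 : forall z, `|z| <= rho -> `|G k z - g z| <= e / 2 by near: k; apply: cG.
have a2 : forall z, `|z| <= rho -> `|H k z - h z| <= e / 2 by near: k; apply: cH.
move=> z hz; rewrite opprD addrACA (splitr e).
apply: (le_trans (ler_normD _ _)); apply: lerD; [exact: a1|exact: a2].
Unshelve. all: by end_near. Qed.

Lemma loc_unif_cvgM G H g h : continuous g -> continuous h -> loc_unif_cvg G g -> loc_unif_cvg H h -> 
  loc_unif_cvg (fun k z => G k z * H k z) (fun z => g z * h z).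
Proof.
move=> cg ch cG cH rho e e0.
have [M1 M10 HM1] := cont_bounded rho cg.
have [M2 M20 HM2] := cont_bounded rho ch.
(* Since [e1 <= 1], the product of the two errors is at most [e1], so the total error is at most
   [e1 * (1 + M2 + M1) <= e]. *)
pose e1 := Num.min 1 (e / (M1 + M2 + 1)).
have e10 : 0 < e1 by rewrite lt_min ltr01 divr_gt0 // !addr_gt0.
near=> k.
have a1' : forall z, `|z| <= rho -> `|G k z - g z| <= e1 by near: k; apply: cG.
have a2' : forall z, `|z| <= rho -> `|H k z - h z| <= e1 by near: k; apply: cH.
move=> z hz; have a1 := a1' z hz; have a2 := a2' z hz.
have -> : G k z * H k z - g z * h z = (G k z - g z) * (H k z - h z) +
   (G k z - g z) * h z + g z * (H k z - h z) by ring.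
have b1 := HM1 _ hz; have b2 := HM2 _ hz.
have e11 : e1 <= 1 by rewrite ge_min lexx.
have e12 : e1 * (M1 + M2 + 1) <= e.
  by rewrite -ler_pdivlMr ?addr_gt0 // ge_min lexx orbT.
apply: le_trans (ler_normD _ _) _; apply: le_trans (lerD (ler_normD _ _) (lexx _)) _.
rewrite !normrM.
have k1 : `|G k z - g z| * `|H k z - h z| <= e1 * 1.
  by apply: ler_pM => //; apply: le_trans a2 e11.
have k2 : `|G k z - g z| * `|h z| <= e1 * M2 by apply: ler_pM.
have k3 : `|g z| * `|H k z - h z| <= M1 * e1 by apply: ler_pM.
nra.
Unshelve. all: by end_near. Qed.

Lemma loc_unif_cvg_shift G g (eps : nat -> R) d : continuous g -> loc_unif_cvg G g ->
  eps @ \oo --> (0 : R) -> loc_unif_cvg (fun k z => G k (z + eps k *: dvec d)) g.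
Proof.
move=> cg cG ce rho e e0; have e2 : 0 < e / 2 by rewrite divr_gt0.
have [dl dl0 Hd] := unif_cont rho cg e2.
have He dd : 0 < dd -> \forall k \near \oo, `|eps k| < dd.
  by move=> dd0; move/cvgr0Pnorm_lt: ce; apply.
near=> k.
(* The shift moves points of the ball outside it, but by less than 1. *)
have a1 : forall z, `|z| <= rho + 1 -> `|G k z - g z| <= e / 2 by near: k; apply: cG.
have ek (dd : R) : `|eps k| < dd -> `|eps k *: dvec d| < dd.
  move=> H; rewrite normrZ; apply: le_lt_trans H.
  by rewrite ler_piMr // norm_dvec.
have h1 : `|eps k *: dvec d| < 1 by apply: ek; near: k; apply: He.
have h2 : `|eps k *: dvec d| < dl by apply: ek; near: k; apply: He.
move=> z hz; rewrite -(subrKA (g (z + eps k *: dvec d))) (splitr e).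
apply: (le_trans (ler_normD _ _)); apply: lerD.
  by apply: a1; apply: le_trans (ler_normD _ _) _; rewrite lerD // ltW.
by rewrite distrC ltW // Hd // opprD addrA subrr sub0r normrN.
Unshelve. all: by end_near. Qed.

Lemma loc_unif_cvg_diff d g g' (eps : nat -> R) : has_deriv d g g' ->
  eps @ \oo --> (0 : R) -> (forall k, 0 < eps k) ->
  loc_unif_cvg (fun k z => (g (z + eps k *: dvec d) - g z) / eps k) g'.
Proof.
move=> D ce e0k rho e e0; have [_ cg' _] := D.
have [dl dl0 Hd] := unif_cont rho cg' e0.
near=> k => z hz.
have [th /andP[th0 th1] ->] := has_deriv_mvt z D (e0k k).
rewrite mulrC mulKf ?gt_eqF // distrC ltW // Hd //.
rewrite opprD addrA subrr sub0r normrN normrZ (@le_lt_trans _ _ `|th|) //.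
  by rewrite ler_piMr // norm_dvec.
rewrite gtr0_norm //; apply: lt_trans th1 _.
have : `|eps k| < dl by near: k; move/cvgr0Pnorm_lt: ce; apply.
by rewrite gtr0_norm.
Unshelve. all: by end_near. Qed.

Lemma has_deriv_back d g g' : has_deriv d g g' -> forall z s,
  is_derive s (1 : R) (fun s => g (z - s *: dvec d)) (- g' (z - s *: dvec d)).
Proof.
case=> _ _ D z s.
have X : is_derive (- s) (1 : R) (fun s => g (z + s *: dvec d)) (g' (z - s *: dvec d)).
  by have := D z (- s); rewrite scaleNr.
have Y : is_derive s (1 : R) (-%R : R -> R) (- 1) by exact: is_deriveNid.
have := is_derive1_comp X Y; rewrite mulrN1.
by congr (is_derive _ _ _ _); apply/funext => y /=; rewrite scaleNr.
Qed.

Lemma loc_unif_cvg_diff2 d g g1 g2 (eps : nat -> R) : has_deriv d g g1 ->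
  has_deriv d g1 g2 -> eps @ \oo --> (0 : R) -> (forall k, 0 < eps k) ->
  loc_unif_cvg (fun k z => (g (z + eps k *: dvec d) + g (z - eps k *: dvec d)
                     - 2 * g z) / eps k ^+ 2) g2.
Proof.
move=> D D2 ce e0k rho e e0; have [_ _ D'] := D; have [_ cg2 _] := D2.
have e2 : 0 < e / 2 by rewrite divr_gt0.
have [dl dl0 Hd] := unif_cont rho cg2 e2.
near=> k => z hz; set h := eps k; have h0 : 0 < h := e0k k.
have hdl : h < dl.
  have : `|eps k| < dl by near: k; move/cvgr0Pnorm_lt: ce; apply.
  by rewrite gtr0_norm.
(* Subtracting [s ^+ 2 * g2 z] makes [G] measure the error. The mean value theorem for [G], then for
   [g1] between [z - c *: dvec d] and [z + c *: dvec d], turns the error into [2 * c / h] times an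
   increment of [g2], where [c < h]. *)
pose G s := g (z + s *: dvec d) + g (z - s *: dvec d) - s ^+ 2 * g2 z.
pose dG s := g1 (z + s *: dvec d) - g1 (z - s *: dvec d) - 2 * s * g2 z.
have DG s : is_derive s (1 : R) G (dG s).
  have X1 := D' z s; have X2 := has_deriv_back D z s.
  have X3 : is_derive s (1 : R) (fun s : R => s ^+ 2 * g2 z) (2 * s * g2 z).
    by apply: is_derive_eq; rewrite /GRing.scale /=; ring.
  rewrite /dG; exact: (is_deriveB (is_deriveD X1 X2) X3).
have cG : {within `[0, h], continuous G}.
  by apply: derivable_within_continuous => y _; exact: (@ex_derive _ _ _ _ _ _ _ (DG y)).
have [c] := MVT h0 (fun x _ => DG x) cG.
rewrite in_itv /= => /andP[c0 ch] E1.
have [th /andP[th0 th1]] := has_deriv_mvt (z - c *: dvec d) D2 (addr_gt0 c0 c0).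
have -> : z - c *: dvec d + (c + c) *: dvec d = z + c *: dvec d.
  by rewrite scalerDl addrA subrK.
rewrite -addrA -!(scaleNr _ (dvec d)) -scalerDl => E2.
have E3 : (g (z + h *: dvec d) + g (z + (- h) *: dvec d) - 2 * g z) / h ^+ 2 - g2 z
   = 2 * c / h * (g2 (z + (- c + th) *: dvec d) - g2 z).
  have hn : h != 0 by rewrite gt_eqF.
  move: E1; rewrite /G /dG -!(scaleNr _ (dvec d)) E2 oppr0 !scale0r !addr0 expr0n /= mul0r !subr0 => E1.
  rewrite -[g (z + h *: dvec d) + _](subrK (h ^+ 2 * g2 z)).
  have -> : g (z + h *: dvec d) + g (z + - h *: dvec d) - h ^+ 2 * g2 z
     = 2 * g z + ((c + c) * g2 (z + (- c + th) *: dvec d) - 2 * c * g2 z) * h.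
    by rewrite -E1; ring.
  by field.
rewrite E3 normrM distrC.
have a1 : `|g2 z - g2 (z + (- c + th) *: dvec d)| < e / 2.
  apply: Hd => //; rewrite opprD addrA subrr sub0r normrN normrZ.
  apply: (@le_lt_trans _ _ `|- c + th|); first by rewrite ler_piMr // norm_dvec.
  by rewrite ltr_norml; apply/andP; split; lra.
have a2 : `|2 * c / h| <= 2.
  by rewrite ger0_norm ?divr_ge0 ?mulr_ge0 ?ltW // ltr_pdivrMr //; lra.
have -> : e = 2 * (e / 2) by field.
by apply: ler_pM => //; apply: ltW.
Unshelve. all: by end_near. Qed.

Lemma has_derivM d g g' h h' : has_deriv d g g' -> has_deriv d h h' ->
  has_deriv d (fun z => g z * h z) (fun z => g z * h' z + h z * g' z).
Proof.
move=> [cg cg' Dg] [ch ch' Dh]; split.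
- by move=> z; apply: cvgM; [exact: cg|exact: ch].
- by move=> z; apply: cvgD; apply: cvgM; [exact: cg|exact: ch'|exact: ch|exact: cg'].
- by move=> z s; exact: (is_deriveM (Dg z s) (Dh z s)).
Qed.

Lemma has_derivZ d g g' (a : R) : has_deriv d g g' ->
  has_deriv d (fun z => a * g z) (fun z => a * g' z).
Proof.
move=> [cg cg' Dg]; split.
- by move=> z; apply: cvgM; [exact: cvg_cst|exact: cg].
- by move=> z; apply: cvgM; [exact: cvg_cst|exact: cg'].
- by move=> z s; exact: (is_deriveZ a (Dg z s)).
Qed.

End Calculus.

(** * Averages over a lattice in a parabolic box *)

Section Lattice.
Variables (R : realType) (n : nat).
Local Notation E := ('rV[R]_n * R)%type.
Local Notation dir := (option 'I_n).
Implicit Types (g h : E -> R) (z : E) (d : dir).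

Definition coord d z : R := if d is Some i then z.1 0 i else z.2.

Lemma coordD d z z' : coord d (z + z') = coord d z + coord d z'.
Proof. by case: d => [i|] //=; rewrite mxE. Qed.

Lemma coordB d z z' : coord d (z - z') = coord d z - coord d z'.
Proof. by case: d => [i|] //=; rewrite !mxE. Qed.

Lemma coord_dvec d d' (a : R) : coord d (a *: dvec R d') = a * (d == d')%:R.
Proof.
case: d => [i|]; case: d' => [j|] /=; rewrite ?mxE ?mulr0 ?mulr1 //.
- by rewrite scaler0.
- by rewrite /GRing.scale /= mulr1.
Qed.

Lemma coord_inj z z' : (forall d, coord d z = coord d z') -> z = z'.
Proof.
case: z z' => [x t] [x' t'] H; congr (_, _); last exact: (H None).
by apply/rowP => i; exact: (H (Some i)).
Qed.

Lemma norm_coord_le z (b : R) : 0 <= b -> (forall d, `|coord d z| <= b) -> `|z| <= b.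
Proof.
move=> b0 H; rewrite norm_pair ge_max (H None) andbT.
rewrite [leLHS]/Num.Def.normr/= mx_normrE bigmax_le // => -[a i] _ /=.
by rewrite (ord1 a); exact: (H (Some i)).
Qed.

Variables (c : E) (r : R).
Hypothesis r0 : 0 < r.

(** Half-widths of the box. Time scales like the square of space, as the heat operator requires. *)
Definition scl d : R := if d is Some _ then r else r ^+ 2.

Lemma scl_gt0 d : 0 < scl d.
Proof. by case: d => [i|] /=; rewrite ?exprn_gt0. Qed.

Definition step d k : R := scl d / k.+1%:R.

Lemma step_gt0 d k : 0 < step d k.
Proof. by rewrite divr_gt0 ?scl_gt0. Qed.

Lemma step_cvg0 d : step d @ \oo --> (0 : R).
Proof.
rewrite -[X in _ --> X](mulr0 (scl d)).
by apply: cvgM; [exact: cvg_cst|exact: cvg_harmonic].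
Qed.

Definition idx k := {ffun dir -> 'I_(k.+1).*2}.

(** Index 0 lies on the lower face, [k.+1] is the centre, and the upper face would be index
    [k.+1.*2], which is left out. The lattice is thus a full period for the cyclic shift. *)
Definition pt k (j : idx k) : E := c +
  (\row_i ((j (Some i))%:R * step (Some i) k - scl (Some i)),
   (j None)%:R * step None k - scl None).

Lemma coord_pt k (j : idx k) d : coord d (pt j - c) = (j d)%:R * step d k - scl d.
Proof.
by rewrite coordB coordD addrAC subrr add0r; case: d => [i|] //=; rewrite mxE.
Qed.

Lemma step_total d k : (k.+1.*2)%:R * step d k = 2 * scl d.
Proof.
rewrite -muln2 natrM /step; have : (k.+1%:R : R) != 0 by [].
by move=> H; field.
Qed.

Lemma pt_box k (j : idx k) d : `|coord d (pt j - c)| <= scl d.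
Proof.
have s0 := ltW (step_gt0 d k).
have : 0 <= (j d)%:R * step d k by rewrite mulr_ge0.
have : (j d)%:R * step d k <= 2 * scl d.
  by rewrite -(step_total d k) ler_wpM2r // ler_nat ltnW.
by rewrite coord_pt ler_norml => ? ?; apply/andP; split; lra.
Qed.

Definition rad : R := `|c| + (r + r ^+ 2).

Lemma pt_rad k (j : idx k) : `|pt j| <= rad.
Proof.
rewrite -[pt j](subrK c) addrC; apply: le_trans (ler_normD _ _) _; rewrite lerD2l.
have r20 : 0 <= r ^+ 2 by rewrite exprn_ge0 ?ltW.
apply: norm_coord_le => [|d]; first by rewrite addr_ge0 // ltW.
apply: le_trans (pt_box j d) _; case: d => [i|] /=; first by rewrite lerDl.
by rewrite lerDr ltW.
Qed.

Definition avg k g : R := (\sum_(j : idx k) g (pt j)) / #|idx k|%:R.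

Lemma idx_gt0 k : (0 : R) < #|idx k|%:R.
Proof. by rewrite ltr0n card_ffun card_ord expn_gt0. Qed.

Lemma avgD k g h : avg k (fun z => g z + h z) = avg k g + avg k h.
Proof. by rewrite /avg big_split mulrDl. Qed.

Lemma avgZ k (a : R) g : avg k (fun z => a * g z) = a * avg k g.
Proof. by rewrite /avg -mulr_sumr mulrA. Qed.

Lemma avgN k g : avg k (fun z => - g z) = - avg k g.
Proof. by rewrite /avg sumrN mulNr. Qed.

Lemma avgB k g h : avg k (fun z => g z - h z) = avg k g - avg k h.
Proof. by rewrite avgD avgN. Qed.

Lemma avg_sum k (I : finType) (G : I -> E -> R) :
  avg k (fun z => \sum_i G i z) = \sum_i avg k (G i).
Proof. by rewrite /avg exchange_big mulr_suml. Qed.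

Lemma eq_avg k g h : (forall z, g z = h z) -> avg k g = avg k h.
Proof. by move=> H; congr (avg k _); apply/funext. Qed.

Lemma avg_le_pt k g h : (forall j : idx k, g (pt j) <= h (pt j)) -> avg k g <= avg k h.
Proof. by move=> H; rewrite ler_pM2r ?invr_gt0 ?idx_gt0 //; apply: ler_sum. Qed.

Lemma avg_le k g h : (forall z, g z <= h z) -> avg k g <= avg k h.
Proof. by move=> H; apply: avg_le_pt. Qed.

Lemma avg_cst k (a : R) : avg k (fun=> a) = a.
Proof.
by rewrite /avg sumr_const -[a *+ _]mulr_natr mulfK // gt_eqF // idx_gt0.
Qed.

Lemma avg_norm_le k g (e : R) : (forall j : idx k, `|g (pt j)| <= e) -> `|avg k g| <= e.
Proof.
move=> H; rewrite ler_norml -[X in X <= _ <= _](avg_cst k) -[X in _ <= _ <= X](avg_cst k).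
by apply/andP; split; apply: avg_le_pt => j; have := H j; rewrite ler_norml => /andP[].
Qed.

Lemma avg_loc_unif_cvg (G : nat -> E -> R) g : loc_unif_cvg G g ->
  (fun k => avg k (G k) - avg k g) @ \oo --> (0 : R).
Proof.
move=> cG; apply/cvgr0Pnorm_le => e e0; near=> k.
have H : forall z, `|z| <= rad -> `|G k z - g z| <= e by near: k; apply: cG.
by rewrite -avgB; apply: avg_norm_le => j; apply: H; exact: pt_rad.
Unshelve. all: by end_near. Qed.

(** The weak inequality includes the faces: a cyclic shift lands on the lower one exactly where the
    true shift lands on the upper one. *)
Definition supported g := forall z d, scl d <= `|coord d (z - c)| -> g z = 0.

Definition next k d (j : idx k) : idx k :=
  [ffun d' => if d' == d then ordS (j d') else j d'].

Lemma next_inj k d : injective (@next k d).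
Proof.
move=> j j' /ffunP H; apply/ffunP => d'; have := H d'; rewrite !ffunE.
by case: ifP => // _; exact: ordS_inj.
Qed.

(* [ordS] is cyclic, but where it wraps around both sides vanish. *)
Lemma supported_next k d (j : idx k) g : supported g ->
  g (pt (next d j)) = g (pt j + step d k *: dvec R d).
Proof.
move=> sg; have [lt|ge] := ltnP (j d).+1 (k.+1).*2.
  congr g; apply: coord_inj => d'; apply/(addIr (- coord d' c)).
  rewrite coordD addrAC -!coordB !coord_pt coord_dvec !ffunE.
  case: eqP => [->|_]; last by rewrite mulr0 addr0.
  by rewrite /= modn_small // -addn1 natrD; ring.
have jE : (j d).+1 = (k.+1).*2 by apply/eqP; rewrite eqn_leq ltn_ord ge.
rewrite (sg _ d) ?(sg _ d) //.
  rewrite coordB coordD addrAC -coordB coord_pt coord_dvec eqxx mulr1.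
  have -> : (j d)%:R * step d k - scl d + step d k = ((j d).+1)%:R * step d k - scl d.
    by rewrite -[(j d).+1]addn1 natrD; ring.
  by rewrite jE step_total mulr_natl mulr2n addrK ler_norm.
rewrite coord_pt ffunE eqxx /= jE modnn mul0r sub0r normrN ler_norm //.
Qed.

Lemma avg_shift k d g : supported g ->
  avg k (fun z => g (z + step d k *: dvec R d)) = avg k g.
Proof.
move=> sg; congr (_ / _); rewrite [RHS](reindex_inj (@next_inj k d)).
by apply: eq_bigr => j _; rewrite supported_next.
Qed.

(** Counterpart of the vanishing integral of a derivative with compact support. The difference
    quotient over exactly one mesh step has average 0 by shift invariance, and it converges locally
    uniformly to [g']. *)
Lemma avg_deriv d g g' : has_deriv d g g' -> supported g ->
  (fun k => avg k g') @ \oo --> (0 : R).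
Proof.
move=> D sg; have := avg_loc_unif_cvg (loc_unif_cvg_diff D (step_cvg0 d) (step_gt0 d)).
move=> /cvgN; rewrite oppr0; apply: cvg_trans; apply: near_eq_cvg.
near=> k; rewrite /= ?fctE opprB.
have -> : avg k (fun z => (g (z + step d k *: dvec R d) - g z) / step d k) =
  (step d k)^-1 * (avg k (fun z => g (z + step d k *: dvec R d)) - avg k g).
  by rewrite -avgB -avgZ; apply: eq_avg => z; rewrite mulrC.
by rewrite avg_shift // subrr mulr0 subr0.
Unshelve. all: by end_near. Qed.

Lemma supportedM g h : supported h -> supported (fun z => g z * h z).
Proof. by move=> sh z d H; rewrite (sh _ _ H) mulr0. Qed.

(* Summation by parts is done on the lattice because the mixed derivatives of
   [u] in the directions [d] and [d'] need not exist; averaging the second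
   difference over two successive times makes the product telescope. *)
Lemma avg_energy_ibp d d' u u1 u2 ut phi phi1 phit :
  has_deriv d u u1 -> has_deriv d u1 u2 -> has_deriv d' u ut ->
  has_deriv d phi phi1 -> has_deriv d' phi phit -> supported phi ->
  (fun k => avg k (fun z => u2 z * ut z * phi z) + avg k (fun z => u1 z * ut z * phi1 z)
     - avg k (fun z => 2^-1 * u1 z ^+ 2 * phit z)) @ \oo --> (0 : R).
Proof.
move=> Du Du1 Dt Dp Dpt sp.
have [cu cu1 _] := Du; have [_ cu2 _] := Du1; have [_ cut _] := Dt.
have [cp cp1 _] := Dp; have [_ cpt _] := Dpt.
have cM (g h : E -> R) : continuous g -> continuous h -> continuous (fun z => g z * h z).
  by move=> cg ch z; apply: cvgM; [exact: cg|exact: ch].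
have cc (a : R) : continuous (fun _ : E => a) by move=> z; exact: cvg_cst.
pose e := step d; pose e' := step d'.
pose v := dvec R d; pose v' := dvec R d'.
have e0 k : 0 < e k := step_gt0 d k.
have e'0 k : 0 < e' k := step_gt0 d' k.
pose A k z := (u (z + e k *: v) - u z) / e k.
pose L k z := (u (z + e k *: v) + u (z - e k *: v) - 2 * u z) / e k ^+ 2.
pose B k z := (u (z + e' k *: v') - u z) / e' k.
have lA : loc_unif_cvg A u1 := loc_unif_cvg_diff Du (step_cvg0 d) e0.
have lB : loc_unif_cvg B ut := loc_unif_cvg_diff Dt (step_cvg0 d') e'0.
have lL : loc_unif_cvg L u2 := loc_unif_cvg_diff2 Du Du1 (step_cvg0 d) e0.
have lAt := loc_unif_cvg_shift d' cu1 lA (step_cvg0 d').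
have lLt := loc_unif_cvg_shift d' cu2 lL (step_cvg0 d').
have lBs := loc_unif_cvg_shift d cut lB (step_cvg0 d).
have lP := loc_unif_cvg_diff Dp (step_cvg0 d) e0.
have lPt := loc_unif_cvg_diff Dpt (step_cvg0 d') e'0.
have lmean G G' (g : E -> R) : continuous g -> loc_unif_cvg G g -> loc_unif_cvg G' g ->
    loc_unif_cvg (fun k z => 2^-1 * (G k z + G' k z)) g.
  move=> cg lG lG'.
  have cgg : continuous (fun z => g z + g z).
    by move=> z; apply: cvgD; exact: cg.
  have := loc_unif_cvgM (cc 2^-1) cgg (loc_unif_cvg_cst _) (loc_unif_cvgD lG lG').
  by congr loc_unif_cvg; apply/funext => z; field.
(* Discrete versions of the three terms. [A] and [L] are averaged over two successive times, and [B]
   is shifted in [Q2], precisely so that the sum becomes an exact difference. *)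
pose Q1 k z := 2^-1 * (L k z + L k (z + e' k *: v')) * B k z * phi z.
pose Q2 k z := 2^-1 * (A k z + A k (z + e' k *: v')) * B k (z + e k *: v)
   * ((phi (z + e k *: v) - phi z) / e k).
pose Q3 k z := 2^-1 * (A k (z + e' k *: v') * A k (z + e' k *: v'))
   * ((phi (z + e' k *: v') - phi z) / e' k).
have l1 : loc_unif_cvg Q1 (fun z => u2 z * ut z * phi z).
  apply: loc_unif_cvgM => //; [exact: cM| |exact: loc_unif_cvg_cst].
  by apply: loc_unif_cvgM => //; exact: lmean.
have l2 : loc_unif_cvg Q2 (fun z => u1 z * ut z * phi1 z).
  apply: loc_unif_cvgM => //; first exact: cM.
  by apply: loc_unif_cvgM => //; exact: lmean.
have l3 : loc_unif_cvg Q3 (fun z => 2^-1 * u1 z ^+ 2 * phit z).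
  apply: loc_unif_cvgM => //; first exact: (cM _ _ (cc _) (cM _ _ cu1 cu1)).
  apply: loc_unif_cvgM => //; [exact: (cM _ _ cu1 cu1)|exact: loc_unif_cvg_cst|exact: loc_unif_cvgM].
have zero k : avg k (Q1 k) + avg k (Q2 k) - avg k (Q3 k) = 0.
  (* [Q1 + Q2 - Q3] is the increment of the flux [P] in direction [d] minus that of the energy
     density [P'] in direction [d']. Two facts are behind it: the quotient of [B] along [d] equals
     that of [A] along [d'], and [(a + a') * (a' - a) = a'^2 - a^2]. *)
  pose P z := (e k)^-1 * (2^-1 * (A k (z - e k *: v) + A k (z - e k *: v + e' k *: v'))
    * B k z * phi z).
  pose P' z := (e' k)^-1 * (2^-1 * A k z ^+ 2 * phi z).
  have sP : supported P by do 2!apply: supportedM.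
  have sP' : supported P' by do 2!apply: supportedM.
  have <- : (avg k (fun z => P (z + e k *: v)) - avg k P)
     - (avg k (fun z => P' (z + e' k *: v')) - avg k P') = 0.
    by rewrite !avg_shift // !subrr.
  rewrite -!avgB -avgD -avgB; apply: eq_avg => z.
  have en : e k != 0 by rewrite gt_eqF.
  have e'n : e' k != 0 by rewrite gt_eqF.
  rewrite /Q1 /Q2 /Q3 /P /P' /A /B /L !addrK !subrK.
  rewrite !(addrAC z (e' k *: v')) !(addrAC _ (e' k *: v') (e k *: v)).
  rewrite ?(addrAC _ (e' k *: v') (- (e k *: v))) ?subrK.
  by field; rewrite en e'n.
have m1 := avg_loc_unif_cvg l1; have m2 := avg_loc_unif_cvg l2; have m3 := avg_loc_unif_cvg l3.
have : (fun k => - ((avg k (Q1 k) - avg k (fun z => u2 z * ut z * phi z))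
   + (avg k (Q2 k) - avg k (fun z => u1 z * ut z * phi1 z))
   - (avg k (Q3 k) - avg k (fun z => 2^-1 * u1 z ^+ 2 * phit z)))) @ \oo
   --> (- (0 + 0 - 0) : R).
  by apply: cvgN; apply: cvgB => //; apply: cvgD.
rewrite addr0 subr0 oppr0; apply: cvg_trans.
apply: near_eq_cvg; near=> k => /=.
have -> (a b c' a' b' c'' : R) : - (a - a' + (b - b') - (c' - c'')) =
  a' + b' - c'' - (a + b - c') by ring.
by rewrite zero subr0.
Unshelve. all: by end_near. Qed.

End Lattice.

(** * A compactly supported weight *)

Section RealDerivatives.
Variable R : realType.

Lemma is_derive_cvg (V W : normedModType R) (f : V -> W) x v a :
  (fun h => h^-1 *: ((f \o shift x) (h *: v) - f x)) @ 0^' --> a -> is_derive x v f a.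
Proof.
by move=> H; apply: DeriveDef; [apply/cvg_ex; exists a|exact/cvg_lim].
Qed.

(** The difference quotient is within [C * |t|] of [a]. The criterion suits quadratic polynomials
    and the square of the positive part, with no separate treatment of the kink. *)
Lemma is_derive_quad (f : R -> R) (x a C : R) :
  (forall t, `|f (t + x) - f x - t * a| <= C * t ^+ 2) -> is_derive x (1 : R) f a.
Proof.
move=> H; apply: is_derive_cvg; apply/cvgrPdist_le => e e0.
have C0 : 0 < `|C| + 1 by rewrite ltr_pwDr.
near=> h.
have h0 : h != 0 by near: h; exact: nbhs_dnbhs_neq.
have he : `|h| <= e / (`|C| + 1).
  by near: h; apply: dnbhs0_le; rewrite divr_gt0.
rewrite /= {1}/GRing.scale /= distrC {1}/GRing.scale /= mulr1.
have -> : h^-1 * (f (h + x) - f x) - a = (f (h + x) - f x - h * a) / h by field.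
rewrite normrM normfV ler_pdivrMr ?normr_gt0 //; apply: le_trans (H h) _.
rewrite -real_normK ?num_real // expr2 mulrA ler_wpM2r //.
move: he; rewrite ler_pdivlMr // => he; apply: le_trans he.
have := ler_norm C; have := normr_ge0 h; nra.
Unshelve. all: by end_near. Qed.

(** The square has remainder at most [t ^+ 2] whatever the signs. Higher powers follow from the
    product rule, since one factor [Num.max 0 s] may be replaced by [s] when another is present; the
    maximum itself is never differentiated. *)
Lemma is_derive_pos_part_exp m (x : R) :
  is_derive x (1 : R) (fun s => Num.max 0 s ^+ m.+2) (m.+2%:R * Num.max 0 x ^+ m.+1).
Proof.
elim: m x => [|m IH] x.
  apply: (@is_derive_quad _ _ _ 1) => t; rewrite mul1r expr1.
  by case: (lerP 0 x) => hx; case: (lerP 0 (t + x)) => htx;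
    rewrite ler_norml; apply/andP; split; nra.
have maxM (s : R) : Num.max 0 s ^+ m.+3 = Num.max 0 s ^+ m.+2 * s.
  by rewrite exprSr; case: (lerP 0 s) => // _; rewrite !expr0n /= !mul0r.
rewrite (_ : (fun _ => _) = (fun s : R => Num.max 0 s ^+ m.+2 * s)); last first.
  by apply/funext => s; exact: maxM.
have := is_deriveM (IH x) (is_derive_id x (1 : R)).
congr (is_derive _ _ _ _).
rewrite /GRing.scale /= mulr1 -[m.+3]addn1 natrD.
have -> : Num.max 0 x ^+ m.+2 = Num.max 0 x ^+ m.+1 * x.
  by rewrite exprSr; case: (lerP 0 x) => // _; rewrite !expr0n /= !mul0r.
ring.
Qed.

End RealDerivatives.

(** * Mass near the centre of the box, uniformly in the mesh *)

Section LowerBound.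
Variables (R : realType) (n : nat) (c : 'rV[R]_n * R) (r : R).
Hypothesis r0 : 0 < r.
Local Notation E := ('rV[R]_n * R)%type.
Local Notation dir := (option 'I_n).

(** Counting from the central index [k.+1] included gives [truncn b + 1] indices, which is at least
    [b] even on a coarse mesh; [b < k.+1] makes them fit in the upper half. *)
Lemma card_upper_half k (b : R) : 0 <= b < k.+1%:R ->
  b <= #|[pred x : 'I_(k.+1).*2 | (k.+1 <= x)%N && ((x - k.+1)%:R <= b)]|%:R.
Proof.
case/andP=> b0 bk; pose t := Num.truncn b.
have tk : (t.+1 <= k.+1)%N by rewrite ltnS truncn_le_nat.
have lt_emb (j : 'I_t.+1) : (k.+1 + j < (k.+1).*2)%N.
  by rewrite -addnn ltn_add2l (leq_trans (ltn_ord j)).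
pose emb j := Ordinal (lt_emb j).
have inj : injective emb by move=> i j [/addnI H]; apply/val_inj.
apply: le_trans (ltW (truncnS_gt b)) _; rewrite ler_nat.
rewrite -[X in (X <= _)%N](card_ord t.+1) -(card_codom inj).
apply: subset_leq_card; apply/fintype.subsetP => x /codomP[j ->].
rewrite inE /= leq_addr /= addKn; have /andP[tb _] := truncn_itv b0; apply: le_trans tb.
by rewrite ler_nat -ltnS.
Qed.

(** Only the lattice points of the one-sided cube of side [s] at [c] are kept. In each direction
    they form a fraction at least [s / (2 * scl r d)] of all indices. *)
Lemma avg_lower k (g : E -> R) (delta s : R) : (forall z, 0 <= g z) -> 0 < s ->
  (forall d : dir, s < scl r d) -> 0 <= delta ->
  (forall z, (forall d : dir, 0 <= coord d (z - c) <= s) -> delta <= g z) ->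
  delta * \prod_(d : dir) (s / (2 * scl r d)) <= avg c r k g.
Proof.
move=> g0 s0 sscl dl0 H.
pose F (d : dir) := [pred x : 'I_(k.+1).*2 | (k.+1 <= x)%N &&
   ((x - k.+1)%:R <= s * k.+1%:R / scl r d)].
pose good : pred (idx n k) := family F.
have -> : avg c r k g = (\sum_(j : idx n k) g (pt c r j)) / \prod_(d : dir) (k.+1.*2)%:R.
  by rewrite /avg card_ffun card_ord -prod_nat_const natr_prod.
rewrite ler_pdivlMr ?prodr_gt0 //.
rewrite -mulrA -big_split /=.
apply: (@le_trans _ _ (\sum_(j in good) delta)); last first.
  rewrite [leRHS](bigID good) /= ler_wpDr ?sumr_ge0 //.
  apply: ler_sum => j /familyP jg; apply: H => d.
  have := jg d; rewrite inE /= => /andP[h1 h2].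
  have st0 := step_gt0 r0 d k.
  have scl0 := scl_gt0 r0 d.
  have -> : coord d (pt c r j - c) = (j d - k.+1)%:R * step r d k.
    rewrite coord_pt natrB // mulrBl; congr (_ - _).
    by rewrite /step mulrC divfK.
  apply/andP; split; first by rewrite mulr_ge0 // ltW.
  rewrite -ler_pdivlMr //.
  by apply: le_trans h2 _; rewrite /step invf_div mulrA.
rewrite sumr_const -[delta *+ _]mulr_natr ler_wpM2l // card_family foldrE big_map big_enum /=.
rewrite natr_prod; apply: ler_prod => d _.
have scl0 := scl_gt0 r0 d.
have e : s / (2 * scl r d) * (k.+1.*2)%:R = s * k.+1%:R / scl r d.
  by rewrite -muln2 natrM; field; rewrite gt_eqF.
have k0 : (0 : R) < k.+1%:R by [].
have b0 : 0 <= s * k.+1%:R / scl r d by rewrite divr_ge0 ?mulr_ge0 // ltW.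
rewrite e b0; apply: card_upper_half; rewrite b0 /=.
by rewrite ltr_pdivrMr // mulrC ltr_pM2l.
Qed.

End LowerBound.

(** * The weight and bounds on its derivatives *)

Section Bump.
Variables (R : realType) (n : nat) (c : 'rV[R]_n * R) (r : R).
Hypothesis r0 : 0 < r.
Local Notation E := ('rV[R]_n * R)%type.
Local Notation dir := (option 'I_n).
Local Notation scl := (scl r).

Definition rho (z : E) : R := 1 - \sum_(d : dir) (coord d (z - c) / scl d) ^+ 2.

Definition bump (z : E) : R := Num.max 0 (rho z).

Definition drho d (z : E) : R := - 2 / scl d ^+ 2 * coord d (z - c).

Lemma bump_ge0 z : 0 <= bump z.
Proof. by rewrite le_max lexx. Qed.

Lemma bump_le1 z : bump z <= 1.
Proof.
rewrite ge_max ler01 /= lerBlDr lerDl sumr_ge0 // => d _; exact: sqr_ge0.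
Qed.

Lemma bump_out d z : scl d <= `|coord d (z - c)| -> bump z = 0.
Proof.
move=> H; apply/max_idPl; rewrite subr_le0 (bigD1 d) //= ler_wpDr ?sumr_ge0 //.
  by move=> d' _; exact: sqr_ge0.
have s0 := scl_gt0 r0 d.
rewrite -real_normK ?num_real // expr_ge1 // normrM normfV (gtr0_norm s0).
by rewrite ler_pdivlMr // mul1r.
Qed.

Lemma supported_bump m : supported c r (fun z => bump z ^+ m.+1).
Proof. by move=> z d H; rewrite (bump_out H) expr0n. Qed.

Lemma continuous_coord d : continuous (@coord R n d).
Proof.
case: d => [i|] z; last exact: cvg_snd.
by apply: (@continuous_comp _ _ _ fst (fun x : 'rV[R]_n => x 0 i));
  [exact: cvg_fst|exact: coord_continuous].
Qed.

Lemma continuous_coordB d : continuous (fun z : E => coord d (z - c)).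
Proof.
move=> z; under eq_fun do rewrite coordB.
by apply: cvgB; [exact: continuous_coord|exact: cvg_cst].
Qed.

Lemma continuous_rho : continuous rho.
Proof.
move=> z; apply: cvgB; first exact: cvg_cst.
apply: cvg_fsum => d; under eq_fun do rewrite expr2.
by apply: cvgM; apply: cvgM; try exact: cvg_cst; exact: continuous_coordB.
Qed.

Lemma continuous_bump : continuous bump.
Proof.
by move=> z; apply: (@continuous_max _ _ (fun=> 0) rho); [exact: cvg_cst|exact: continuous_rho].
Qed.

Lemma continuous_bumpX m : continuous (fun z => bump z ^+ m).
Proof. elim: m => [|m IH] z.
  by under eq_fun do rewrite expr0; exact: cvg_cst.
by under eq_fun do rewrite exprS; apply: cvgM; [exact: continuous_bump|exact: IH]. Qed.

Lemma continuous_drho d : continuous (drho d).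
Proof. by move=> z; apply: cvgM; [exact: cvg_cst|exact: continuous_coordB]. Qed.

Lemma coord_line d d' z (s : R) :
  coord d' (z + s *: dvec R d - c) = coord d' (z - c) + s * (d' == d)%:R.
Proof. by rewrite addrAC coordD coord_dvec. Qed.

Lemma rho_line d z (s : R) :
  rho (z + s *: dvec R d) = rho z + s * drho d z - s ^+ 2 / scl d ^+ 2.
Proof.
have s0 : scl d != 0 by rewrite gt_eqF // scl_gt0.
rewrite /rho (bigD1 d) //= [in RHS](bigD1 d) //= coord_line eqxx mulr1.
rewrite (eq_bigr (fun d' => (coord d' (z - c) / scl d') ^+ 2)).
  by rewrite /drho; set S := BIG_F; field.
by move=> d' /negPf nd; rewrite coord_line nd mulr0 addr0.
Qed.

Lemma is_derive_rho d z (s : R) :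
  is_derive s (1 : R) (fun s => rho (z + s *: dvec R d)) (drho d (z + s *: dvec R d)).
Proof.
apply: (@is_derive_quad _ _ _ _ (scl d ^+ 2)^-1) => t.
have s0 : 0 < scl d by rewrite scl_gt0.
have -> : z + (t + s) *: dvec R d = (z + s *: dvec R d) + t *: dvec R d.
  by rewrite scalerDl addrA addrAC.
set y := z + _; rewrite rho_line.
have -> : rho y + t * drho d y - t ^+ 2 / scl d ^+ 2 - rho y - t * drho d y =
  - ((scl d ^+ 2)^-1 * t ^+ 2) by rewrite mulrC; ring.
by rewrite normrN ger0_norm // mulr_ge0 ?invr_ge0 ?sqr_ge0.
Qed.

Lemma has_deriv_bump d m : has_deriv d (fun z => bump z ^+ m.+2)
  (fun z => m.+2%:R * bump z ^+ m.+1 * drho d z).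
Proof.
split; first exact: continuous_bumpX.
  move=> z; apply: cvgM; last exact: continuous_drho.
  by apply: cvgM; [exact: cvg_cst|exact: continuous_bumpX].
move=> z s.
have H := @is_derive1_comp R (fun s => Num.max 0 s ^+ m.+2)
  (fun s => rho (z + s *: dvec R d)) s _ _ (is_derive_pos_part_exp m (rho (z + s *: dvec R d)))
  (is_derive_rho d z s).
exact: H.
Qed.

Lemma has_deriv_drho d : has_deriv d (drho d) (fun=> - 2 / scl d ^+ 2).
Proof.
split; [exact: continuous_drho|by move=> z; exact: cvg_cst|].
move=> z s; apply: (@is_derive_quad _ _ _ _ 0) => t.
rewrite mul0r /drho !coord_line eqxx !mulr1.
set a := - 2 / _; set b := coord _ _.
have -> : a * (b + (t + s)) - a * (b + s) - t * a = 0 by ring.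
by rewrite normr0.
Qed.

(** Second derivative of [bump ^ m.+3] in direction [d], as the product rule delivers it. *)
Definition bump2 d m z := m.+3%:R * bump z ^+ m.+2 * (- 2 / scl d ^+ 2)
  + drho d z * (m.+3%:R * (m.+2%:R * bump z ^+ m.+1 * drho d z)).

Lemma has_deriv_bump2 d m : has_deriv d
  (fun z => m.+3%:R * bump z ^+ m.+2 * drho d z) (bump2 d m).
Proof. exact: has_derivM (has_derivZ _ (has_deriv_bump d m)) (has_deriv_drho d). Qed.

(** [drho] is unbounded on the whole space, so the weight stays on both sides: outside the box it
    vanishes, inside the coordinate is below [scl d]. *)
Lemma bump_drho_le d m z : `|drho d z| * bump z ^+ m.+1 <= 2 / scl d * bump z ^+ m.+1.
Proof.
have s0 := scl_gt0 r0 d.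
have [/bump_out ->|lt] := leP (scl d) `|coord d (z - c)|.
  by rewrite expr0n !mulr0.
rewrite ler_wpM2r ?exprn_ge0 ?bump_ge0 // /drho normrM normrM normrN normfV.
rewrite [`|2|]ger0_norm // [`|scl d ^+ 2|]ger0_norm ?sqr_ge0 //.
have -> : 2 / scl d = 2 / scl d ^+ 2 * scl d by field; exact/lt0r_neq0.
by apply: ler_wpM2l; [rewrite divr_ge0 ?sqr_ge0|exact: ltW].
Qed.

Lemma norm_dbump d m z :
  `|m.+2%:R * bump z ^+ m.+1 * drho d z| <= 2 * m.+2%:R / scl d * bump z ^+ m.+1.
Proof.
have b0 := exprn_ge0 m.+1 (bump_ge0 z).
rewrite 2!normrM normr_nat (ger0_norm b0) -mulrA [_ ^+ _ * _]mulrC.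
apply: le_trans (ler_wpM2l _ (bump_drho_le d m z)) _ => //.
by rewrite le_eqVlt; apply/orP; left; apply/eqP; ring.
Qed.

(** The constant 6 is 2 + 4: the derivative of [drho] contributes 2, and the square of the bound
    [2 / scl d] for [drho] contributes 4. *)
Lemma norm_bump2 d m z : `|bump2 d m z| <= 6 * m.+3%:R ^+ 2 / scl d ^+ 2 * bump z ^+ m.+1.
Proof.
have s0 := scl_gt0 r0 d.
have b0 := exprn_ge0 m.+1 (bump_ge0 z); have b20 := exprn_ge0 m.+2 (bump_ge0 z).
have [/bump_out out|lt] := leP (scl d) `|coord d (z - c)|.
  by rewrite /bump2 out !expr0n /= !(mulr0, mul0r, addr0) normr0.
have dr : `|drho d z| <= 2 / scl d.
  rewrite /drho !normrM normrN normfV.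
  rewrite [`|2|]ger0_norm // [`|scl d ^+ 2|]ger0_norm ?sqr_ge0 //.
  have -> : 2 / scl d = 2 / scl d ^+ 2 * scl d by field; exact/lt0r_neq0.
  by apply: ler_wpM2l; [rewrite divr_ge0 ?sqr_ge0|exact: ltW].
have m3 : (1 : R) <= m.+3%:R by rewrite ler1n.
have m23 : (m.+2%:R : R) <= m.+3%:R by rewrite ler_nat.
have m20 : (0 : R) <= m.+2%:R by [].
have i0 : 0 <= (scl d ^+ 2)^-1 by rewrite invr_ge0 sqr_ge0.
rewrite /bump2; set D := drho d z in dr *; apply: le_trans (ler_normD _ _) _.
have -> : 6 * m.+3%:R ^+ 2 / scl d ^+ 2 * bump z ^+ m.+1 =
  2 * m.+3%:R ^+ 2 / scl d ^+ 2 * bump z ^+ m.+1 +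
  4 * m.+3%:R ^+ 2 / scl d ^+ 2 * bump z ^+ m.+1 by ring.
apply: lerD.
  have q : 0 <= m.+3%:R * bump z ^+ m.+2 by exact: mulr_ge0.
  rewrite normrM (ger0_norm q).
  have -> : `|- 2 / scl d ^+ 2| = 2 / scl d ^+ 2.
    by rewrite normrM normrN normfV [`|scl d ^+ 2|]ger0_norm ?sqr_ge0 // ger0_norm.
  have bb : bump z ^+ m.+2 <= bump z ^+ m.+1.
    by rewrite exprS ler_piMl // bump_le1.
  have -> : m.+3%:R * bump z ^+ m.+2 * (2 / scl d ^+ 2) =
    2 * (scl d ^+ 2)^-1 * (m.+3%:R * bump z ^+ m.+2) by ring.
  have -> : 2 * m.+3%:R ^+ 2 / scl d ^+ 2 * bump z ^+ m.+1 =
    2 * (scl d ^+ 2)^-1 * (m.+3%:R ^+ 2 * bump z ^+ m.+1) by ring.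
  apply: ler_wpM2l; first by rewrite mulr_ge0.
  apply: ler_pM => //; by rewrite expr2 ler_peMl.
rewrite normrM [`|_ * (_ * D)|]normrM [`|_ * D|]normrM normr_nat.
have q : 0 <= m.+2%:R * bump z ^+ m.+1 by exact: mulr_ge0.
rewrite (ger0_norm q).
have -> : `|D| * (m.+3%:R * (m.+2%:R * bump z ^+ m.+1 * `|D|)) =
   `|D| ^+ 2 * (m.+3%:R * m.+2%:R) * bump z ^+ m.+1 by ring.
have -> : 4 * m.+3%:R ^+ 2 / scl d ^+ 2 = (2 / scl d) ^+ 2 * (m.+3%:R * m.+3%:R) :> R.
  by field; rewrite gt_eqF.
rewrite ler_wpM2r // ler_pM ?sqr_ge0 ?mulr_ge0 ?ler_wpM2l //.
by rewrite !expr2; apply: ler_pM.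
Qed.

End Bump.

(** * Energy identities *)

Section Null.
Variables (R : realType) (n : nat) (c : 'rV[R]_n * R) (r : R).
Local Notation E := ('rV[R]_n * R)%type.
Implicit Types g h : E -> R.

(** Lattice form of the statement that the integral of [h] over the box is zero. *)
Definition null h := (fun k => avg c r k h) @ \oo --> (0 : R).

Lemma nullD g h : null g -> null h -> null (fun z => g z + h z).
Proof.
move=> ng nh; rewrite /null (_ : (fun _ => _) = (fun k => avg c r k g + avg c r k h)).
  by rewrite -[X in _ --> X](addr0 0); exact: cvgD.
by apply/funext => k; exact: avgD.
Qed.

Lemma nullZ a h : null h -> null (fun z => a * h z).
Proof.
move=> nh; rewrite /null (_ : (fun _ => _) = (fun k => a * avg c r k h)).
  by rewrite -[X in _ --> X](mulr0 a); apply: cvgM => //; exact: cvg_cst.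
by apply/funext => k; exact: avgZ.
Qed.

Lemma nullB g h : null g -> null h -> null (fun z => g z - h z).
Proof.
move=> ng nh; have := nullD ng (nullZ (-1) nh).
by congr null; apply/funext => z; rewrite mulN1r.
Qed.

Lemma null_sum (I : finType) (h : I -> E -> R) :
  (forall i, null (h i)) -> null (fun z => \sum_i h i z).
Proof.
move=> nh; rewrite /null (_ : (fun _ => _) = (fun k => \sum_i avg c r k (h i))).
  have := @cvg_fsum R nat \oo _ I (fun i k => avg c r k (h i)) (fun=> 0) nh.
  have -> : \sum_(i : I) (0 : R) = 0 by rewrite big1.
  exact.
by apply/funext => k; exact: avg_sum.
Qed.

Lemma eq_null g h : (forall z, g z = h z) -> null g -> null h.
Proof. by move=> /funext ->. Qed.

Hypothesis r0 : 0 < r.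

Lemma null_ibp d a a' b b' : has_deriv d a a' -> has_deriv d b b' ->
  supported c r b -> null (fun z => a z * b' z + b z * a' z).
Proof. by move=> Da Db sb; exact: (avg_deriv r0 (has_derivM Da Db) (supportedM a sb)). Qed.

Lemma null_energy_ibp d d' u u1 u2 ut phi phi1 phit :
  has_deriv d u u1 -> has_deriv d u1 u2 -> has_deriv d' u ut ->
  has_deriv d phi phi1 -> has_deriv d' phi phit -> supported c r phi ->
  null (fun z => u2 z * ut z * phi z + u1 z * ut z * phi1 z
                 - 2^-1 * u1 z ^+ 2 * phit z).
Proof.
move=> D1 D2 D3 D4 D5 sp.
rewrite /null (_ : (fun _ => _) = (fun k => avg c r k (fun z => u2 z * ut z * phi z)
   + avg c r k (fun z => u1 z * ut z * phi1 z)
   - avg c r k (fun z => 2^-1 * u1 z ^+ 2 * phit z))).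
  exact: (avg_energy_ibp r0 D1 D2 D3 D4 D5 sp).
by apply/funext => k; rewrite avgB avgD.
Qed.

End Null.

(** Weighted Young inequality: the difference of the two sides dominates a completed square. With
    [nn = n], summing over the space directions spends only half of the [x ^+ 2] term, which can
    then be absorbed. *)
Lemma cross_term_le (R : realType) (x y P b B k r nn : R) : 0 < r -> 0 < nn -> 0 <= B ->
  `|P| <= 2 * k / r * (b * B) -> - (y * x * P) <=
    (2 * nn)^-1 * (x ^+ 2 * (b ^+ 2 * B)) + 2 * nn * k ^+ 2 / r ^+ 2 * (y ^+ 2 * B).
Proof.
move=> r0 n0 B0 HP.
have q1 : - (y * x * P) <= `|x| * `|y| * (2 * k / r * (b * B)).
  apply: le_trans (ler_norm _) _; rewrite normrN normrM [`|y * x|]normrM (mulrC `|y|).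
  by apply: ler_wpM2l => //; exact: mulr_ge0.
apply: le_trans q1 _.
rewrite -(real_normK (num_real x)) -(real_normK (num_real y)) -subr_ge0.
rewrite (_ : _ - _ = (2 * nn)^-1 * (`|x| * b - 2 * nn * k / r * `|y|) ^+ 2 * B).
  by apply: mulr_ge0 => //; apply: mulr_ge0; rewrite ?sqr_ge0 // invr_ge0; lra.
by field; rewrite !gt_eqF.
Qed.

(** * Testing the equation with the weight, with the solution and with its time derivative *)

Section Energy.
Variables (R : realType) (n N : nat).
Local Notation E := ('rV[R]_n * R)%type.
Variables (u ut : 'I_N -> E -> R) (du d2u : 'I_N -> 'I_n -> E -> R) (G : E -> R).
(** The nonlinearity enters only as the heat operator applied to [u a]; [HG] is the chain rule for
    the potential along the solution. *)
Let f a z := ut a z - \sum_i d2u a i z.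
Hypothesis Hut : forall a, has_deriv None (u a) (ut a).
Hypothesis Hdu : forall a i, has_deriv (Some i) (u a) (du a i).
Hypothesis Hd2u : forall a i, has_deriv (Some i) (du a i) (d2u a i).
Hypothesis HG : has_deriv None G (fun z => \sum_a f a z * ut a z).

Section FixedBox.
Variables (c : E) (r : R).
Hypothesis r0 : 0 < r.
Local Notation null := (null c r).
Local Notation bump := (bump c r).
Local Notation phi m z := (bump z ^+ m.+3).
Local Notation dphi d m z := (m.+3%:R * bump z ^+ m.+2 * drho c r d z).
Local Notation d2phi i m z := (bump2 c r (Some i) m z).
Local Notation heat m z := (dphi None m z + \sum_i d2phi i m z).

Lemma supported_dphi d m : supported c r (fun z => dphi d m z).
Proof. by move=> z d' H; rewrite (bump_out r0 H) expr0n /= mulr0 mul0r. Qed.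

(** One integration by parts in time and two in space move all derivatives to the weight; [heat] is
    its time derivative plus its Laplacian. *)
Lemma null_test a m : null (fun z => f a z * phi m z + u a z * heat m z).
Proof.
have n1 := null_ibp r0 (Hut a) (has_deriv_bump c r0 None m.+1) (supported_bump r0 m.+2).
have n2 i := null_ibp r0 (Hd2u a i) (has_deriv_bump c r0 (Some i) m.+1)
  (supported_bump r0 m.+2).
have n3 i := null_ibp r0 (Hdu a i) (has_deriv_bump2 c r0 (Some i) m)
  (supported_dphi (Some i) m).
have := nullB n1 (null_sum (fun i => nullB (n2 i) (n3 i))).
apply: eq_null => z; rewrite /f mulrDr mulr_sumr mulrBl mulr_suml.
rewrite (eq_bigr (fun i => d2u a i z * phi m z - u a z * d2phi i m z)).
  by rewrite sumrB; ring.
by move=> i _; ring.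
Qed.

(** Obtained by testing with [u a] times the weight. Derivatives of [u ^+ 2 / 2] are moved to the
    weight, which leaves the Dirichlet energy in terms of [u * f] and [u ^+ 2]. *)
Lemma null_grad a m : null (fun z => \sum_i du a i z ^+ 2 * phi m z
  - u a z * f a z * phi m z - 2^-1 * u a z ^+ 2 * heat m z).
Proof.
have nt := null_ibp r0 (has_derivM (Hut a) (Hut a)) (has_deriv_bump c r0 None m.+1)
  (supported_bump r0 m.+2).
have n1 i := null_ibp r0 (Hd2u a i) (has_derivM (Hdu a i) (has_deriv_bump c r0 (Some i) m.+1))
  (supportedM (u a) (supported_bump r0 m.+2)).
have n2 i := null_ibp r0 (has_derivM (Hdu a i) (Hdu a i)) (has_deriv_bump2 c r0 (Some i) m)
  (supported_dphi (Some i) m).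
have := nullB (null_sum (fun i => nullB (n1 i) (nullZ 2^-1 (n2 i)))) (nullZ 2^-1 nt).
apply: eq_null => z; rewrite (eq_bigr (fun i => du a i z ^+ 2 * phi m z
  + u a z * phi m z * d2u a i z - 2^-1 * u a z ^+ 2 * d2phi i m z)).
  set S := \sum_i d2phi i m z.
  by rewrite !big_split /= sumrN -!mulr_sumr -/S /f; field.
by move=> i _; field.
Qed.

(** Obtained by testing with [ut a] times the weight. The product [f * ut] is the time derivative of
    [G], which passes to the weight; the Laplacian term is handled by [null_energy_ibp]. *)
Lemma null_time m : null (fun z => \sum_a ut a z ^+ 2 * phi m z
  + G z * dphi None m z + \sum_a \sum_i (du a i z * ut a z * dphi (Some i) m z
     - 2^-1 * du a i z ^+ 2 * dphi None m z)).
Proof.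
have n1 a i := null_energy_ibp r0 (Hdu a i) (Hd2u a i) (Hut a)
  (has_deriv_bump c r0 (Some i) m.+1) (has_deriv_bump c r0 None m.+1)
  (supported_bump r0 m.+2).
have n2 := null_ibp r0 HG (has_deriv_bump c r0 None m.+1) (supported_bump r0 m.+2).
have := nullD n2 (null_sum (fun a => null_sum (n1 a))).
apply: eq_null => z; rewrite -addrA -[RHS]addrA [RHS]addrCA; congr (_ + _).
rewrite mulr_sumr -!big_split /=; apply: eq_bigr => a _.
have -> : phi m z * (f a z * ut a z) =
  ut a z ^+ 2 * phi m z - \sum_i d2u a i z * ut a z * phi m z.
  by rewrite -!mulr_suml /f; ring.
rewrite -addrA; congr (_ + _).
rewrite -sumrN -big_split /=; apply: eq_bigr => i _; ring.
Qed.

Lemma exp_bump_le m k z : bump z ^+ (k + m) <= bump z ^+ m.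
Proof. by rewrite exprD ler_piMl ?exprn_ge0 ?exprn_ile1 ?bump_ge0 ?bump_le1. Qed.

Lemma norm_heat m z : `|heat m z| <= 6 * n.+1%:R * m.+3%:R ^+ 2 / r ^+ 2 * bump z ^+ m.+1.
Proof.
have b0 := exprn_ge0 m.+1 (bump_ge0 c r z).
have r20 : 0 < r ^+ 2 by rewrite exprn_gt0.
have m31 : (1 : R) <= m.+3%:R by rewrite ler1n.
have h1 : `|dphi None m z| <= 6 * m.+3%:R ^+ 2 / r ^+ 2 * bump z ^+ m.+1.
  apply: le_trans (norm_dbump c r0 None m.+1 z) _.
  apply: (@le_trans _ _ (2 * m.+3%:R / r ^+ 2 * bump z ^+ m.+1)).
    apply: ler_wpM2l; last exact: (exp_bump_le m.+1 1).
    by rewrite divr_ge0 ?mulr_ge0 // ltW.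
  by rewrite ler_wpM2r // ler_pM2r ?invr_gt0 //; nra.
apply: le_trans (ler_normD _ _) _.
have -> : 6 * n.+1%:R * m.+3%:R ^+ 2 / r ^+ 2 * bump z ^+ m.+1 =
  6 * m.+3%:R ^+ 2 / r ^+ 2 * bump z ^+ m.+1 +
  \sum_(i < n) 6 * m.+3%:R ^+ 2 / r ^+ 2 * bump z ^+ m.+1.
  by rewrite sumr_const card_ord -[_ *+ n]mulr_natl -[n.+1]addn1 natrD; ring.
apply: lerD => //; apply: le_trans (ler_norm_sum _ _ _) _; apply: ler_sum => i _.
exact: norm_bump2.
Qed.

End FixedBox.

Variables (Y : E -> R) (C : R).
Hypothesis C0 : 0 <= C.
Hypothesis Y0 : forall z, 0 <= Y z.
Hypothesis GY : forall z, `|G z| <= C * Y z.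
Hypothesis ufY : forall z, \sum_a u a z * f a z <= C * Y z.

(* Each integration by parts costs two powers of the weight, hence the
   exponents m+3, m+5 and m+7. *)
Lemma energy_estimate m : exists2 K, 0 <= K & forall c r, 0 < r ->
  exists2 e : nat -> R, e @ \oo --> (0 : R) & forall k,
    avg c r k (fun z => \sum_a ut a z ^+ 2 * bump c r z ^+ m.+4.+3) <=
    K / r ^+ 2 * (avg c r k (fun z => Y z * bump c r z ^+ m.+3)
      + (r ^+ 2)^-1 * avg c r k (fun z => (\sum_a u a z ^+ 2) * bump c r z ^+ m.+3)) + e k.
Proof.
(* In [K2], the part [2 * n * kap ^ 2] comes from Young's inequality in [cross], and [2 * kap]
   covers the time derivative of the weight against [G] and against the gradient. [K3] is half the
   constant of [norm_heat], because of the factor 1/2 in [null_grad]. *)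
pose kap : R := m.+4.+3%:R; pose K2 : R := 2 * n%:R * kap ^+ 2 + 2 * kap.
pose kap' : R := m.+4.+1%:R; pose K3 : R := 3 * n.+1%:R * kap' ^+ 2.
have kap0 : 0 <= kap by []. have kap'0 : 0 <= kap' by [].
have n0 : (0 : R) <= n%:R by [].
have K20 : 0 <= K2 by rewrite addr_ge0 // !mulr_ge0 // exprn_ge0.
have K30 : 0 <= K3 by rewrite !mulr_ge0 // exprn_ge0.
exists (2 * K2 * (2 * C + K3)); first by rewrite !mulr_ge0 // addr_ge0 // mulr_ge0.
move=> c r r0; pose b := bump c r.
have r20 : 0 < r ^+ 2 by rewrite exprn_gt0.
have b0 j z : 0 <= b z ^+ j by rewrite exprn_ge0 // bump_ge0.
have ble j i z : b z ^+ (i + j) <= b z ^+ j by exact: exp_bump_le.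
pose h3 z := \sum_a ut a z ^+ 2 * b z ^+ m.+4.+3
  + G z * (kap * b z ^+ m.+4.+2 * drho c r None z)
  + \sum_a \sum_i (du a i z * ut a z * (kap * b z ^+ m.+4.+2 * drho c r (Some i) z)
     - 2^-1 * du a i z ^+ 2 * (kap * b z ^+ m.+4.+2 * drho c r None z)).
have nh3 : null c r h3 := null_time c r0 m.+4.
pose heat z := kap' * b z ^+ m.+4 * drho c r None z + \sum_i bump2 c r (Some i) m.+2 z.
pose h2 a z := \sum_i du a i z ^+ 2 * b z ^+ m.+4.+1
  - u a z * f a z * b z ^+ m.+4.+1 - 2^-1 * u a z ^+ 2 * heat z.
have nh2 a : null c r (h2 a) := null_grad c r0 a m.+2.
(* The two identities are combined with these coefficients: 2 undoes the absorption of half of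
   [ut ^+ 2], and [2 * K2 / r ^+ 2] trades the gradient for zero-order terms. What remains is a
   pointwise inequality. *)
exists (fun k => 2 * avg c r k h3 + 2 * K2 / r ^+ 2 * avg c r k (fun z => \sum_a h2 a z)).
  have := nullD (nullZ 2 nh3) (nullZ (2 * K2 / r ^+ 2) (null_sum nh2)).
  by rewrite /null; under eq_fun do rewrite avgD !avgZ.
move=> k; rewrite -!avgZ -avgD -avgZ -!avgD; apply: avg_le => z.
have dt : `|kap * b z ^+ m.+4.+2 * drho c r None z| <= 2 * kap / r ^+ 2 * b z ^+ m.+4.+1.
  apply: le_trans (norm_dbump c r0 None _ z) _.
  by rewrite ler_wpM2l ?(ble _ 1) // divr_ge0 ?mulr_ge0 // ltW.
have di i : `|kap * b z ^+ m.+4.+2 * drho c r (Some i) z| <= 2 * kap / r * b z ^+ m.+4.+2.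
  exact: norm_dbump.
have ht : `|heat z| <= 2 * K3 / r ^+ 2 * b z ^+ m.+3.
  apply: le_trans (norm_heat c r0 m.+2 z) _.
  by rewrite le_eqVlt; apply/orP; left; apply/eqP; rewrite /K3; ring.
have cross a i : - (du a i z * ut a z * (kap * b z ^+ m.+4.+2 * drho c r (Some i) z)
     - 2^-1 * du a i z ^+ 2 * (kap * b z ^+ m.+4.+2 * drho c r None z)) <=
   (2 * n%:R)^-1 * (ut a z ^+ 2 * b z ^+ m.+4.+3)
    + K2 / r ^+ 2 * (du a i z ^+ 2 * b z ^+ m.+4.+1).
  have nn0 : (0 : R) < n%:R by rewrite ltr0n (leq_ltn_trans (leq0n i)).
  set x := ut a z; set y := du a i z; set B := b z ^+ m.+4.+1.
  set P := _ * drho c r (Some i) z; set Q := _ * drho c r None z.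
  have dP : `|P| <= 2 * kap / r * (b z * B) by rewrite -exprS; exact: di.
  have q2 : 2^-1 * y ^+ 2 * Q <= 2^-1 * y ^+ 2 * (2 * kap / r ^+ 2 * B).
    apply: ler_wpM2l; first by apply: mulr_ge0 => //; exact: sqr_ge0.
    exact: le_trans (ler_norm _) dt.
  have q3 := cross_term_le x y r0 nn0 (b0 m.+4.+1 z : 0 <= B) dP.
  rewrite opprB addrC.
  have -> : b z ^+ m.+4.+3 = b z ^+ 2 * B by rewrite -exprD.
  apply: le_trans (lerD q3 q2) _.
  rewrite -addrA lerD2l -subr_ge0 (_ : _ - _ = kap / r ^+ 2 * (y ^+ 2 * B)).
    apply: mulr_ge0; first by rewrite divr_ge0 // ltW.
    by apply: mulr_ge0; [exact: sqr_ge0|exact: b0].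
  by rewrite /K2; field; rewrite gt_eqF.
have s3 : 2^-1 * (\sum_a ut a z ^+ 2 * b z ^+ m.+4.+3) <= h3 z
   + K2 / r ^+ 2 * (`|G z| * b z ^+ m.+4.+1
       + \sum_a \sum_i du a i z ^+ 2 * b z ^+ m.+4.+1).
  have g1 : - (G z * (kap * b z ^+ m.+4.+2 * drho c r None z)) <=
     K2 / r ^+ 2 * (`|G z| * b z ^+ m.+4.+1).
    move: (kap * b z ^+ m.+4.+2 * drho c r None z) dt => Q dt.
    apply: le_trans (ler_norm _) _; rewrite normrN normrM mulrCA ler_wpM2l //.
    apply: le_trans dt _; rewrite ler_wpM2r // ler_pM2r ?invr_gt0 // /K2 lerDr.
    by rewrite !mulr_ge0 // sqr_ge0.
  have g2 : - (\sum_a \sum_i (du a i z * ut a z * (kap * b z ^+ m.+4.+2 * drho c r (Some i) z)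
     - 2^-1 * du a i z ^+ 2 * (kap * b z ^+ m.+4.+2 * drho c r None z))) <=
     2^-1 * (\sum_a ut a z ^+ 2 * b z ^+ m.+4.+3) +
     K2 / r ^+ 2 * (\sum_a \sum_i du a i z ^+ 2 * b z ^+ m.+4.+1).
    rewrite -sumrN !mulr_sumr -big_split /=; apply: ler_sum => a _.
    rewrite -sumrN mulr_sumr.
    apply: le_trans (ler_sum _ (fun i _ => cross a i)) _.
    rewrite big_split /= lerD2r sumr_const card_ord -[_ *+ n]mulr_natl mulrA.
    apply: ler_wpM2r; first by apply: mulr_ge0; [exact: sqr_ge0|exact: b0].
    (* Without space directions the left side is 0; otherwise the [n] shares [(2 * n)^-1] add up to
       one half. *)
    case: (eqVneq (n%:R : R) 0) => [->|np]; first by rewrite mul0r invr_ge0.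
    by rewrite invfM mulrCA mulfV ?mulr1.
  rewrite /h3; move: g1 g2; set S1 := \sum_a ut a z ^+ 2 * _; set S2 := \sum_a _.
  set S3 := \sum_a \sum_i du a i z ^+ 2 * _; rewrite mulrDr; lra.
have s2 : \sum_a \sum_i du a i z ^+ 2 * b z ^+ m.+4.+1 <=
   \sum_a h2 a z + C * Y z * b z ^+ m.+4.+1 + K3 / r ^+ 2 * ((\sum_a u a z ^+ 2) * b z ^+ m.+3).
  have t1 : C * Y z * b z ^+ m.+4.+1 >= \sum_a u a z * f a z * b z ^+ m.+4.+1.
    by rewrite -mulr_suml ler_wpM2r.
  apply: le_trans (lerD (lerD (lexx _) t1) (lexx _)).
  rewrite mulr_suml mulr_sumr -!big_split /=; apply: ler_sum => a _.
  rewrite /h2 -lerBlDl.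
  set S := \sum_i _; set T := u a z * _ * _.
  have -> : S - (S - T - 2^-1 * u a z ^+ 2 * heat z + T) = 2^-1 * u a z ^+ 2 * heat z by ring.
  apply: (@le_trans _ _ (2^-1 * u a z ^+ 2 * (2 * K3 / r ^+ 2 * b z ^+ m.+3))).
    apply: ler_wpM2l; first by apply: mulr_ge0; rewrite ?sqr_ge0 // invr_ge0.
    exact: le_trans (ler_norm _) ht.
  by rewrite le_eqVlt; apply/orP; left; apply/eqP; field; rewrite gt_eqF.
have bb : b z ^+ m.+4.+1 <= b z ^+ m.+3 by exact: (ble m.+3 2).
have yb : Y z * b z ^+ m.+4.+1 <= Y z * b z ^+ m.+3 by rewrite ler_wpM2l.
have gb : `|G z| * b z ^+ m.+4.+1 <= C * (Y z * b z ^+ m.+3).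
  by rewrite mulrA; apply: ler_pM => //; exact: b0.
rewrite -/b; set T1 := \sum_a ut a z ^+ 2 * _; set W := (\sum_a u a z ^+ 2) * _.
have W0 : 0 <= W by rewrite mulr_ge0 ?b0 // sumr_ge0 // => a _; rewrite sqr_ge0.
have YB0 : 0 <= Y z * b z ^+ m.+3 by rewrite mulr_ge0.
have kr : 0 <= K2 / r ^+ 2 by rewrite divr_ge0 // ltW.
have yb' : C * Y z * b z ^+ m.+4.+1 <= C * (Y z * b z ^+ m.+3).
  by rewrite -mulrA ler_wpM2l.
have tot : `|G z| * b z ^+ m.+4.+1 + \sum_a \sum_i du a i z ^+ 2 * b z ^+ m.+4.+1 <=
   \sum_a h2 a z + (2 * C + K3) * (Y z * b z ^+ m.+3 + (r ^+ 2)^-1 * W).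
  have CW : 0 <= C * ((r ^+ 2)^-1 * W) by apply: mulr_ge0 => //; apply: mulr_ge0 => //; rewrite invr_ge0 ltW.
  have KY : 0 <= K3 * (Y z * b z ^+ m.+3) by rewrite mulr_ge0.
  have KW : K3 / r ^+ 2 * W = K3 * ((r ^+ 2)^-1 * W) by rewrite -mulrA.
  move: s2; rewrite -/W KW; nra.
have fin := ler_wpM2l kr tot.
have -> : T1 = 2 * (2^-1 * T1) by field.
have fin2 := le_trans s3 (lerD (lexx (h3 z)) fin).
have : 2 * (2^-1 * T1) <= 2 * (h3 z + K2 / r ^+ 2 * (\sum_a h2 a z +
   (2 * C + K3) * (Y z * b z ^+ m.+3 + (r ^+ 2)^-1 * W))) by rewrite ler_wpM2l.
move=> /le_trans; apply; rewrite le_eqVlt; apply/orP; left; apply/eqP.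
by field; rewrite gt_eqF.
Qed.

End Energy.

(** * Vanishing of the time derivative *)

Section PowerInequalities.
Variable R : realType.
Implicit Types x b delta L p s tau : R.

(** Compare [delta ^ (p - 1) * L] with [x ^ (p - 1) * b ^ 2]. If it is smaller, multiply by
    [x * b ^ m.+1]. If not, taking the root of order [p - 1] bounds [x * b ^ (2 / (p - 1))], and
    [b ^ m.+1] is smaller still because [b <= 1] and [m.+1 >= 2 / (p - 1)]. *)
Lemma young_bump x b delta L p (m : nat) : 1 < p -> 0 <= x -> 0 <= b <= 1 ->
  0 < delta -> 0 < L -> 2 <= m.+1%:R * (p - 1) ->
  delta `^ (p - 1) * L * (x * b ^+ m.+1) <=
  x `^ p * b ^+ m.+3 + L * L `^ (p - 1)^-1 * delta `^ p.
Proof.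
move=> p1 x0 /andP[b0 b1] d0 L0 hm.
have p10 : 0 < p - 1 by rewrite subr_gt0.
have p0 : 0 < p by rewrite (lt_trans ltr01).
have xb0 : 0 <= x * b ^+ m.+1 by rewrite mulr_ge0 // exprn_ge0.
have dp0 := powR_gt0 (p - 1) d0.
have [le|lt] := leP (delta `^ (p - 1) * L) (x `^ (p - 1) * b ^+ 2).
  apply: (@le_trans _ _ (x `^ p * b ^+ m.+3)); last first.
    by rewrite lerDl !mulr_ge0 ?powR_ge0 // ltW.
  apply: le_trans (ler_wpM2r xb0 le) _.
  rewrite -(mulr_powRB1 x0 p0) -[m.+3]addn2 exprD le_eqVlt; apply/orP; left.
  by apply/eqP; ring.
apply: (@le_trans _ _ (L * L `^ (p - 1)^-1 * delta `^ p)); last first.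
  by rewrite lerDr mulr_ge0 ?powR_ge0 // exprn_ge0.
have key : x * b ^+ m.+1 <= L `^ (p - 1)^-1 * delta.
  have e (y : R) : 0 <= y -> y = (y `^ (p - 1)) `^ (p - 1)^-1.
    by move=> y0; rewrite -powRrM mulfV ?gt_eqF // powRr1.
  have le1 : (x * b ^+ m.+1) `^ (p - 1) <= delta `^ (p - 1) * L.
    apply: le_trans (ltW lt); rewrite powRM ?exprn_ge0 //.
    apply: ler_wpM2l; first exact: powR_ge0.
    rewrite -powR_mulrn // -powRrM -powR_mulrn //.
    have [->|bn] := eqVneq b 0.
      by rewrite !powR0 // ?mulf_neq0 ?gt_eqF.
    by rewrite ger_powR // b1 lt0r bn b0.
  have i0 : 0 <= (p - 1)^-1 by rewrite invr_ge0 ltW.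
  apply: (@le_trans _ _ ((delta `^ (p - 1) * L) `^ (p - 1)^-1)).
    rewrite {1}(e _ xb0); apply: ge0_ler_powR => //; rewrite nnegrE ?powR_ge0 //.
    by apply: mulr_ge0; [exact: powR_ge0|exact: ltW].
  by rewrite powRM ?powR_ge0 ?(ltW L0) // -(e _ (ltW d0)) mulrC.
apply: le_trans (ler_wpM2l _ key) _; first by rewrite mulr_ge0 ?powR_ge0 // ltW.
by rewrite -(mulr_powRB1 (ltW d0) p0) le_eqVlt; apply/orP; left; apply/eqP; ring.
Qed.

(** Below [delta] the last term dominates; above it, [x ^ (tau - p) <= delta ^ (tau - p)] because
    the exponent is not positive. *)
Lemma powR_interp x delta tau p : 0 <= x -> 0 < delta -> 0 < tau -> tau <= p ->
  x `^ tau <= delta `^ (tau - p) * x `^ p + delta `^ tau.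
Proof.
move=> x0 d0 t0 tp; have [xd|dx] := leP x delta.
  apply: (@le_trans _ _ (delta `^ tau)); last by rewrite lerDr mulr_ge0 ?powR_ge0.
  by rewrite ge0_ler_powR ?nnegrE // ltW.
apply: (@le_trans _ _ (delta `^ (tau - p) * x `^ p)); last by rewrite lerDl powR_ge0.
have xp : 0 < x by exact: lt_trans dx.
have -> : x `^ p = x `^ tau * x `^ (p - tau).
  have cnd : (tau + (p - tau) == 0) ==> (x != 0) by rewrite (gt_eqF xp) implybT.
  by rewrite -(powRD cnd) addrC subrK.
rewrite mulrCA ler_peMr ?powR_ge0 // -opprB powRN ler_pdivlMl ?powR_gt0 // mulr1.
by rewrite ge0_ler_powR ?nnegrE ?subr_ge0 // ltW.
Qed.

Lemma le_lim_add (a b : R) (e : nat -> R) : e @ \oo --> (0 : R) ->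
  (forall k, a <= b + e k) -> a <= b.
Proof.
move=> ce H; apply/ler_addgt0Pr => eps eps0.
move/cvgr0Pnorm_le: ce => /(_ _ eps0) [k _ /(_ k (leqnn k))] /= hk.
by apply: le_trans (H k) _; rewrite lerD2l (le_trans (ler_norm _)).
Qed.

End PowerInequalities.

(** * Decay of averages on growing boxes *)

Section ScalarLiouville.
Variables (R : realType) (n N : nat).
Local Notation E := ('rV[R]_n * R)%type.
Variables (u ut : 'I_N -> E -> R) (du d2u : 'I_N -> 'I_n -> E -> R) (G : E -> R).
Let f a z := ut a z - \sum_i d2u a i z.
Hypothesis Hut : forall a, has_deriv None (u a) (ut a).
Hypothesis Hdu : forall a i, has_deriv (Some i) (u a) (du a i).
Hypothesis Hd2u : forall a i, has_deriv (Some i) (du a i) (d2u a i).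
Hypothesis HG : has_deriv None G (fun z => \sum_a f a z * ut a z).
Variables (p q c0 C D : R) (xi : 'I_N -> R) (X : E -> R).
Hypothesis p1 : 1 < p.
Hypothesis c00 : 0 < c0.
Hypothesis X0 : forall z, 0 <= X z.
Hypothesis uX : forall a z, `|u a z| <= X z.
Hypothesis superlin : forall z, c0 * X z `^ p <= \sum_a xi a * f a z.

Let p10 : 0 < p - 1. Proof. by rewrite subr_gt0. Qed.
Let p0 : 0 < p. Proof. by rewrite (lt_trans ltr01). Qed.

(** The self-similar rate of the equation with a nonlinearity of degree [p], fixed by
    [decay r ^ (p - 1) = r ^ -2]. *)
Definition decay (r : R) : R := r `^ (- (2 / (p - 1))).

Lemma decay_gt0 r : 0 < r -> 0 < decay r.
Proof. exact: powR_gt0. Qed.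

Lemma decay_powB1 r : 0 < r -> decay r `^ (p - 1) = (r ^+ 2)^-1.
Proof.
move=> r0; rewrite /decay -powRrM mulNr divfK ?gt_eqF // powRN.
by rewrite powR_mulrn // ltW.
Qed.

Variable m : nat.
Hypothesis hm : 2 <= m.+1%:R * (p - 1).

(** Superlinearity and [null_test] bound [c0 * X ^ p * bump ^ m.+3] on average by
    [K4 / r ^ 2 * X * bump ^ m.+1]. The choice [L = 2 * K4 / c0] lets [young_bump] at
    [delta = decay r] absorb half of the left side. *)
Lemma test_estimate : exists2 K, 0 <= K & forall c r, 0 < r ->
  exists2 e : nat -> R, e @ \oo --> (0 : R) & forall k,
    avg c r k (fun z => X z `^ p * bump c r z ^+ m.+3) <= K * decay r `^ p + e k.
Proof.
(* The summand 1 makes [K4], hence [L], positive. *)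
pose K4 : R := (\sum_a `|xi a|) * (6 * n.+1%:R * m.+3%:R ^+ 2) + 1.
have K40 : 0 < K4.
  rewrite ltr_pwDr //; apply: mulr_ge0; first exact: sumr_ge0.
  by apply: mulr_ge0 => //; exact: sqr_ge0.
pose L : R := 2 * K4 / c0; have L0 : 0 < L by rewrite divr_gt0 // mulr_gt0.
exists (L * L `^ (p - 1)^-1); first by rewrite mulr_ge0 ?powR_ge0 // ltW.
move=> c r r0; pose b := bump c r.
have r20 : 0 < r ^+ 2 by rewrite exprn_gt0.
pose heat z := m.+3%:R * b z ^+ m.+2 * drho c r None z + \sum_i bump2 c r (Some i) m z.
pose h z := \sum_a xi a * (f a z * b z ^+ m.+3 + u a z * heat z).
have nh : null c r h.
  by apply: null_sum => a; apply: nullZ; exact: (null_test Hut Hdu Hd2u c r0 a m).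
exists (fun k => 2 / c0 * avg c r k h).
  by have := nullZ (2 / c0) nh; rewrite /null; under eq_fun do rewrite avgZ.
move=> k; rewrite -avgZ -[X in _ <= X + _](avg_cst c r k) -avgD; apply: avg_le => z.
rewrite -/b; have b0 : 0 <= b z by exact: bump_ge0.
have b1 : b z <= 1 by exact: bump_le1.
have yg := @young_bump R (X z) (b z) (decay r) L p m p1 (X0 z) _ (decay_gt0 r0) L0 hm.
rewrite b0 b1 decay_powB1 // in yg.
have {}yg := yg isT.
have ht : `|heat z| <= 6 * n.+1%:R * m.+3%:R ^+ 2 / r ^+ 2 * b z ^+ m.+1.
  exact: norm_heat.
have B0 : 0 <= b z ^+ m.+1 by rewrite exprn_ge0.
have B30 : 0 <= b z ^+ m.+3 by rewrite exprn_ge0.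
have hz : c0 * (X z `^ p * b z ^+ m.+3) <= h z + K4 / r ^+ 2 * (X z * b z ^+ m.+1).
  rewrite mulrA; apply: le_trans (ler_wpM2r B30 (superlin z)) _.
  rewrite mulr_suml -lerBlDl -sumrB.
  apply: (@le_trans _ _ (\sum_a `|xi a| * (X z * (6 * n.+1%:R * m.+3%:R ^+ 2 / r ^+ 2 * b z ^+ m.+1)))).
    apply: ler_sum => a _.
    rewrite (_ : _ - _ = - (xi a * (u a z * heat z))); last by ring.
    apply: le_trans (ler_norm _) _; rewrite normrN [`|xi a * _|]normrM.
    apply: ler_wpM2l => //; rewrite [`|u a z * _|]normrM.
    by apply: ler_pM.
  rewrite -mulr_suml -subr_ge0 (_ : _ - _ = (r ^+ 2)^-1 * (X z * b z ^+ m.+1)).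
    by apply: mulr_ge0; [rewrite invr_ge0 ltW|exact: mulr_ge0].
  by rewrite /K4; ring.
have yg2 : K4 / r ^+ 2 * (X z * b z ^+ m.+1) <=
   c0 / 2 * (X z `^ p * b z ^+ m.+3 + L * L `^ (p - 1)^-1 * decay r `^ p).
  have c20 : 0 <= c0 / 2 by rewrite divr_ge0 // ltW.
  apply: le_trans (ler_wpM2l c20 yg); rewrite /L le_eqVlt; apply/orP; left; apply/eqP.
  by field; rewrite !gt_eqF.
move: hz yg2; move: (X z `^ p * _) (L * _ * _) (K4 / _ * _) => A1 A2 A3 hz yg2.
have : c0 * A1 <= c0 * (A2 + 2 / c0 * h z).
  rewrite mulrDr mulrA (_ : c0 * (2 / c0) = 2); last by field; rewrite gt_eqF.
  by lra.
by rewrite ler_pM2l.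
Qed.

Hypothesis XD : forall z, X z <= D.
Hypothesis D0 : 0 <= D.

(** Up to [p], interpolate at the level [decay r]. Beyond [p], the extra factor is only bounded by a
    power of [D] and brings no further decay, hence the minimum. *)
Lemma power_estimate tau : 0 < tau -> exists2 K, 0 <= K & forall c r, 0 < r ->
  exists2 e : nat -> R, e @ \oo --> (0 : R) & forall k,
    avg c r k (fun z => X z `^ tau * bump c r z ^+ m.+3) <=
    K * decay r `^ (Num.min tau p) + e k.
Proof.
move=> t0; have [K K0 HK] := test_estimate.
have [tp|pt] := leP tau p.
  exists (K + 1); first by rewrite addr_ge0.
  move=> c r r0; have [e ce He] := HK c r r0.
  have d0 := decay_gt0 r0.
  exists (fun k => decay r `^ (tau - p) * e k).
    by rewrite -[X in _ --> X](mulr0 (decay r `^ (tau - p))); apply: cvgM => //; exact: cvg_cst.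
  move=> k; apply: (@le_trans _ _ (avg c r k (fun z =>
     decay r `^ (tau - p) * (X z `^ p * bump c r z ^+ m.+3) + decay r `^ tau))).
    apply: avg_le => z; have b0 := bump_ge0 c r z; have b1 := bump_le1 c r z.
    have B0 : 0 <= bump c r z ^+ m.+3 by rewrite exprn_ge0.
    apply: le_trans (ler_wpM2r B0 (powR_interp (X0 z) d0 t0 tp)) _.
    by rewrite mulrDl mulrA lerD2l ler_piMr ?powR_ge0 // exprn_ile1.
  rewrite avgD avgZ avg_cst mulrDl mul1r addrAC lerD2r.
  apply: le_trans (ler_wpM2l (powR_ge0 _ _) (He k)) _.
  have cnd : (tau - p + p == 0) ==> (decay r != 0) by rewrite (gt_eqF d0) implybT.
  by rewrite mulrDr lerD2r mulrCA -(powRD cnd) subrK.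
exists (D `^ (tau - p) * K); first by rewrite mulr_ge0 ?powR_ge0.
move=> c r r0; have [e ce He] := HK c r r0.
exists (fun k => D `^ (tau - p) * e k).
  by rewrite -[X in _ --> X](mulr0 (D `^ (tau - p))); apply: cvgM => //; exact: cvg_cst.
move=> k; rewrite -mulrA -mulrDr.
apply: le_trans (ler_wpM2l (powR_ge0 _ _) (He k)).
rewrite -avgZ; apply: avg_le => z; rewrite mulrA; apply: ler_wpM2r.
  by rewrite exprn_ge0 // bump_ge0.
have -> : X z `^ tau = X z `^ (tau - p) * X z `^ p.
  have cnd : (tau - p + p == 0) ==> (X z != 0) by rewrite subrK (gt_eqF t0).
  by rewrite -(powRD cnd) subrK.
apply: ler_wpM2r; first exact: powR_ge0.
by rewrite ge0_ler_powR ?nnegrE // subr_ge0 ltW.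
Qed.

Hypothesis C0 : 0 <= C.
Hypothesis q0 : 0 <= q.
Hypothesis GX : forall z, `|G z| <= C * X z `^ (q + 1).
Hypothesis ufX : forall z, \sum_a u a z * f a z <= C * X z `^ (q + 1).

(** The energy estimate with [Y = X ^ (q + 1)]. Its quadratic term is reduced to the first power by
    [u ^ 2 <= D * X]; the resulting [r ^ -2 * decay r] is good enough because [n < 2 + 2 / (p - 1)]
    amounts to [n * (p - 1) < 2 * p]. *)
Lemma time_derivative_estimate : exists2 K, 0 <= K & forall c r, 0 < r ->
  exists2 e : nat -> R, e @ \oo --> (0 : R) & forall k,
    avg c r k (fun z => \sum_a ut a z ^+ 2 * bump c r z ^+ m.+4.+3) <=
    K / r ^+ 2 * (decay r `^ (Num.min (q + 1) p) + (r ^+ 2)^-1 * decay r) + e k.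
Proof.
have Y0 z : 0 <= X z `^ (q + 1) by exact: powR_ge0.
have [K K0 HK] := energy_estimate Hut Hdu Hd2u HG C0 Y0 GX ufX m.
have [K1 K10 HK1] := power_estimate (ltr_wpDl q0 ltr01 : 0 < q + 1).
have [K2 K20 HK2] := power_estimate (ltr01 : 0 < (1 : R)).
pose A : R := N%:R * D.
have A0 : 0 <= A by exact: mulr_ge0.
exists (K * (K1 + A * K2)).
  by apply: mulr_ge0 => //; apply: addr_ge0 => //; exact: mulr_ge0.
move=> c r r0; have [e ce He] := HK c r r0.
have [e1 ce1 He1] := HK1 c r r0; have [e2 ce2 He2] := HK2 c r r0.
have r20 : 0 < r ^+ 2 by rewrite exprn_gt0.
have i0 : 0 <= (r ^+ 2)^-1 by rewrite invr_ge0 ltW.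
have k0 : 0 <= K / r ^+ 2 by exact: mulr_ge0.
exists (fun k => K / r ^+ 2 * (e1 k + (r ^+ 2)^-1 * (A * e2 k)) + e k).
  rewrite -[X in _ --> X](_ : K / r ^+ 2 * (0 + (r ^+ 2)^-1 * (A * 0)) + 0 = 0).
    apply: cvgD => //; apply: cvgM; first exact: cvg_cst.
    apply: cvgD => //; apply: cvgM; first exact: cvg_cst.
    by apply: cvgM => //; exact: cvg_cst.
  by rewrite !(mulr0, addr0).
move=> k; apply: le_trans (He k) _; rewrite addrA lerD2r.
have d0 := decay_gt0 r0.
have -> : K * (K1 + A * K2) / r ^+ 2 *
   (decay r `^ Num.min (q + 1) p + (r ^+ 2)^-1 * decay r) +
   K / r ^+ 2 * (e1 k + (r ^+ 2)^-1 * (A * e2 k)) =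
   K / r ^+ 2 * ((K1 + A * K2) * (decay r `^ Num.min (q + 1) p + (r ^+ 2)^-1 * decay r)
     + (e1 k + (r ^+ 2)^-1 * (A * e2 k))) by ring.
apply: ler_wpM2l => //.
have t1 := He1 k.
have t2 : avg c r k (fun z => (\sum_a u a z ^+ 2) * bump c r z ^+ m.+3) <= A * (K2 * decay r + e2 k).
  have := He2 k; rewrite (min_idPl (ltW p1)) powRr1 ?(ltW d0) // => t2.
  apply: le_trans (ler_wpM2l A0 t2); rewrite -avgZ; apply: avg_le => z.
  rewrite mulrA; apply: ler_wpM2r; first by rewrite exprn_ge0 // bump_ge0.
  rewrite powRr1 // /A -mulrA mulr_natl -[X in _ *+ X](card_ord N) -sumr_const.
  apply: ler_sum => a _; rewrite -real_normK ?num_real // expr2.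
  apply: ler_pM => //; apply: le_trans (uX a z) (XD z).
have t3 := ler_wpM2l i0 t2.
apply: le_trans (lerD t1 t3) _; rewrite -subr_ge0.
set d1 := decay r `^ _; set dr := decay r in d0 *.
rewrite (_ : _ - _ = K1 * ((r ^+ 2)^-1 * dr) + A * K2 * d1); last by ring.
by apply: addr_ge0; repeat (apply: mulr_ge0 => //); rewrite ?powR_ge0 // ltW.
Qed.

Lemma prod_scl (r : R) : \prod_(d : option 'I_n) scl r d = r ^+ n * r ^+ 2.
Proof.
rewrite (bigD1 None) //= mulrC; congr (_ * _).
rewrite (reindex_omap Some id) /=; last by case.
rewrite (eq_bigl (fun=> true)) => [|i]; last by rewrite eqxx.
by rewrite prodr_const card_ord.
Qed.

Lemma avg_bump_lower (H : E -> R) (z0 : E) : continuous H -> (forall z, 0 <= H z) ->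
  0 < H z0 -> exists2 delta, 0 < delta & forall r k, 1 <= r ->
    delta / (r ^+ n * r ^+ 2) <= avg z0 r k (fun z => H z * bump z0 r z ^+ m.+4.+3).
Proof.
move=> cH H0 Hz0.
have H20 : 0 < H z0 / 2 by rewrite divr_gt0.
have [dl dl0 Hd] := unif_cont `|z0| cH H20.
(* The side is independent of [r] and [k]. [dl / 2] keeps [H] above half its value at [z0]; the
   other bound makes each of the [n + 1] squares in [rho] at most [1 / (2 * (n + 1))], so the weight
   is at least 1/2. *)
pose s : R := Num.min (dl / 2) (2 * n.+1%:R)^-1.
have n1 : (1 : R) <= n.+1%:R by rewrite ler1n.
have s0 : 0 < s by rewrite lt_min divr_gt0 //= invr_gt0; lra.
have sdl : s < dl by rewrite gt_min; apply/orP; left; lra.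
have sn : s <= (2 * n.+1%:R)^-1 by rewrite ge_min lexx orbT.
have s2 : s <= 2^-1 by apply: le_trans sn _; rewrite lef_pV2 ?posrE; lra.
pose delta := H z0 / 2 * 2^-1 ^+ m.+4.+3.
have delta0 : 0 < delta by rewrite mulr_gt0 // exprn_gt0 // invr_gt0.
exists (delta * \prod_(d : option 'I_n) (s / 2)).
  by rewrite mulr_gt0 // prodr_gt0 // => d _; rewrite divr_gt0.
move=> r k r1; have r0 : 0 < r by exact: lt_le_trans r1.
have scl1 (d : option 'I_n) : 1 <= scl r d by case: d => [i|] //=; rewrite exprn_ege1.
rewrite -prod_scl -mulrA -prodf_div.
rewrite (eq_bigr (fun d => s / (2 * scl r d))); last first.
  by move=> d _; rewrite invfM mulrA.
apply: avg_lower => //.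
- by move=> z; rewrite mulr_ge0 // exprn_ge0 // bump_ge0.
- by move=> d; apply: lt_le_trans (scl1 d); lra.
- exact: ltW.
move=> z hz; rewrite /delta.
have zn : `|z0 - z| <= s.
  rewrite -normrN opprB; apply: norm_coord_le => [|d]; first exact: ltW.
  by have /andP[h1 h2] := hz d; rewrite ger0_norm.
apply: ler_pM; rewrite ?exprn_ge0 ?invr_ge0 ?(ltW H20) //.
  have := Hd z0 z (lexx _) (le_lt_trans zn sdl).
  by rewrite ltr_norml => /andP[h1 h2]; lra.
rewrite lerXn2r ?nnegrE ?bump_ge0 ?invr_ge0 //.
rewrite le_max; apply/orP; right; rewrite /rho.
have : \sum_(d : option 'I_n) (coord d (z - z0) / scl r d) ^+ 2 <=
   \sum_(d : option 'I_n) (2 * n.+1%:R)^-1.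
  apply: ler_sum => d _; have /andP[h1 h2] := hz d.
  have sd := scl1 d; have sd0 : 0 < scl r d by exact: lt_le_trans sd.
  have q1 : coord d (z - z0) / scl r d <= s.
    by rewrite ler_pdivrMr //; apply: le_trans h2 _; rewrite ler_peMr // ltW.
  have q2 : 0 <= coord d (z - z0) / scl r d by rewrite divr_ge0 // ltW.
  have q3 : coord d (z - z0) / scl r d <= 1 by lra.
  by apply: le_trans sn; apply: le_trans q1; rewrite expr2 ler_piMl.
rewrite sumr_const card_option card_ord -[_ *+ n.+1]mulr_natl.
rewrite (_ : n.+1%:R * (2 * n.+1%:R)^-1 = 2^-1); last by field; lra.
lra.
Qed.

Hypothesis hn : n%:R * (p - 1) < 2 * p.
Hypothesis hq : q < p - 1 -> n%:R * (p - 1) < 2 * (q + 1).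

Lemma time_derivative_eq0_aux a z : ut a z = 0.
Proof.
apply/eqP/negP => /negP ut0.
pose H z := \sum_a ut a z ^+ 2.
have cH : continuous H.
  move=> y; apply: cvg_fsum => a'; under eq_fun do rewrite expr2.
  by have [_ cu _] := Hut a'; rewrite expr2; apply: cvgM; exact: cu.
have H0 y : 0 <= H y by apply: sumr_ge0 => a' _; exact: sqr_ge0.
have Hz : 0 < H z.
  rewrite /H (bigD1 a) //= ltr_pwDl ?sumr_ge0 // => [|a' _]; last exact: sqr_ge0.
  by rewrite exprn_even_gt0.
have [delta d0 Hd] := avg_bump_lower cH H0 Hz.
have [K K0 HK] := time_derivative_estimate.
pose s := 2 / (p - 1).
have sp : s * (p - 1) = 2 by rewrite divfK // gt_eqF.
have s0 : 0 < s by rewrite divr_gt0.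
pose sg := Num.min (q + 1) p.
(* After multiplication by [r ^ (n + 2)] the powers [n - s * sg] and [n - 2 - s] of [r] remain;
   [- eta] is the larger. Its negativity is where [hn] and [hq] enter. *)
pose eta := Num.min (s * sg - n%:R) (s + 2 - n%:R).
have eta0 : 0 < eta.
  have e (x : R) : n%:R * (p - 1) < 2 * x -> n%:R < s * x.
    by move=> h; rewrite -(ltr_pM2r p10) mulrAC sp.
  rewrite lt_min !subr_gt0; apply/andP; split; last first.
    have -> : s + 2 = s * p by rewrite -sp; ring.
    exact: e.
  apply: e; rewrite /sg; have [h|h] := ltP (q + 1) p => //.
  by apply: hq; rewrite ltrBrDr.
have key r : 1 <= r -> delta <= 2 * K * r `^ (- eta).
  move=> r1; have r0 : 0 < r by exact: lt_le_trans r1.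
  have [e ce He] := HK z r r0.
  have r20 : 0 < r ^+ 2 by rewrite exprn_gt0.
  have : delta / (r ^+ n * r ^+ 2) <=
      K / r ^+ 2 * (decay r `^ sg + (r ^+ 2)^-1 * decay r).
    apply: le_lim_add ce _ => k; apply: le_trans (He k); apply: le_trans (Hd r k r1) _.
    by apply: avg_le => y; rewrite mulr_suml.
  rewrite ler_pdivrMr ?mulr_gt0 ?exprn_gt0 // => /le_trans; apply.
  have cnd (x y : R) : (x + y == 0) ==> (r != 0) by rewrite (gt_eqF r0) implybT.
  have rn (x : R) : r ^+ n * r `^ x = r `^ (n%:R + x).
    by rewrite -powR_mulrn ?(ltW r0) // -(powRD (cnd _ _)).
  have -> : K / r ^+ 2 * (decay r `^ sg + (r ^+ 2)^-1 * decay r) * (r ^+ n * r ^+ 2) =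
     K * (r ^+ n * decay r `^ sg + r ^+ n * ((r ^+ 2)^-1 * decay r)).
    by field; rewrite gt_eqF.
  have -> : decay r `^ sg = r `^ (- (s * sg)) by rewrite /decay -powRrM mulNr.
  have -> : (r ^+ 2)^-1 * decay r = r `^ (- 2 - s).
    by rewrite (powRD (cnd _ _)) powRN powR_mulrn // ltW.
  rewrite !rn (_ : 2 * K * _ = K * (2 * r `^ (- eta))); last by ring.
  apply: ler_wpM2l => //.
  have le_eta (x : R) : x <= - eta -> r `^ x <= r `^ (- eta) by move=> h; rewrite ler_powR.
  rewrite mulr2n mulrDl mul1r; apply: lerD; apply: le_eta.
    by rewrite lerNr opprD opprK addrC ge_min lexx.
  rewrite (_ : n%:R + (- 2 - s) = - (s + 2 - n%:R)); last by ring.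
  by rewrite lerN2 ge_min lexx orbT.
(* An explicit radius replaces the limit: at [r = B ^ (1 / eta)] the bound reads
   [delta * B <= 2 * K], whereas [delta * B = 2 * K + delta]. *)
pose B := 2 * K / delta + 1.
have B1 : 1 <= B by rewrite lerDr divr_ge0 ?mulr_ge0 // ltW.
have B0 : 0 < B by exact: lt_le_trans B1.
have := key (B `^ eta^-1).
rewrite -powRrM mulrN mulVf ?gt_eqF // powR_inv1 ?(ltW B0) //.
rewrite -[X in X <= _ -> _](powRr0 B) ler_powR ?invr_ge0 ?(ltW eta0) // => /(_ isT).
rewrite ler_pdivlMr // /B mulrDr mulr1 mulrC divfK ?gt_eqF //; lra.
Qed.

End ScalarLiouville.

Theorem time_derivative_eq0 (R : realType) (n N : nat)
    (u ut : 'I_N -> 'rV[R]_n * R -> R) (du d2u : 'I_N -> 'I_n -> 'rV[R]_n * R -> R)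
    (G : 'rV[R]_n * R -> R) (p q c0 C D : R) (xi : 'I_N -> R) (X : 'rV[R]_n * R -> R) :
  let f a z := ut a z - \sum_i d2u a i z in
  (forall a, has_deriv None (u a) (ut a)) ->
  (forall a i, has_deriv (Some i) (u a) (du a i)) ->
  (forall a i, has_deriv (Some i) (du a i) (d2u a i)) ->
  has_deriv None G (fun z => \sum_a f a z * ut a z) ->
  1 < p -> 0 <= q -> 0 < c0 -> 0 <= C -> 0 <= D ->
  n%:R * (p - 1) < 2 * p -> (q < p - 1 -> n%:R * (p - 1) < 2 * (q + 1)) ->
  (forall z, 0 <= X z <= D) -> (forall a z, `|u a z| <= X z) ->
  (forall z, c0 * X z `^ p <= \sum_a xi a * f a z) ->
  (forall z, `|G z| <= C * X z `^ (q + 1)) ->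
  (forall z, \sum_a u a z * f a z <= C * X z `^ (q + 1)) ->
  forall a z, ut a z = 0.
Proof.
move=> f Hut Hdu Hd2u HG p1 q0 c00 C0 D0 hn hq HX uX sup GX ufX a z.
have X0 z' : 0 <= X z' by have /andP[] := HX z'.
have XD z' : X z' <= D by have /andP[] := HX z'.
(* Makes [m.+1] exceed [2 / (p - 1)], the weight exponent required by [young_bump]. *)
pose m := Num.truncn (2 / (p - 1)).
have hm : 2 <= m.+1%:R * (p - 1).
  by rewrite -ler_pdivrMr ?subr_gt0 // ltW // truncnS_gt.
exact: (time_derivative_eq0_aux Hut Hdu Hd2u HG p1 c00 X0 uX sup hm XD D0 C0 q0 GX ufX hn hq).
Qed.

(** * Parabolic solutions *)

Section Enorm.
Variables (R : realType) (N : nat).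
Implicit Types v w : 'rV[R]_N.

Lemma enorm_ge0 v : 0 <= enorm v.
Proof. exact: sqrtr_ge0. Qed.

Lemma coord_le_enorm v a : `|v 0 a| <= enorm v.
Proof.
rewrite -sqrtr_sqr; apply: ler_wsqrtr; rewrite /dotv (bigD1 a) //= expr2 lerDl.
by apply: sumr_ge0 => b _; rewrite -expr2 sqr_ge0.
Qed.

Lemma enorm_le_sum v : enorm v <= \sum_a `|v 0 a|.
Proof.
have s0 : 0 <= \sum_a `|v 0 a| by apply: sumr_ge0.
rewrite -(ger0_norm s0) -sqrtr_sqr; apply: ler_wsqrtr.
rewrite expr2 mulr_suml; apply: ler_sum => a _.
rewrite -expr2 -real_normK ?num_real // expr2; apply: ler_wpM2l => //.
by rewrite (bigD1 a) //= lerDl sumr_ge0.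
Qed.

Lemma dotv_le_sum v w : `|dotv v w| <= enorm v * \sum_a `|w 0 a|.
Proof.
apply: le_trans (ler_norm_sum _ _ _) _; rewrite mulr_sumr; apply: ler_sum => a _.
by rewrite normrM ler_wpM2r // coord_le_enorm.
Qed.

(** Cauchy-Schwarz up to the factor [N], which is harmless in estimates with unspecified
    constants. *)
Lemma dotv_le_enorm v w : `|dotv v w| <= N%:R * (enorm v * enorm w).
Proof.
apply: le_trans (dotv_le_sum v w) _; rewrite mulrCA ler_wpM2l ?enorm_ge0 //.
rewrite mulr_natl -[X in _ *+ X](card_ord N) -sumr_const; apply: ler_sum => a _.
exact: coord_le_enorm.
Qed.

Lemma ler_enormZ (a : R) v : 0 <= a <= 1 -> enorm (a *: v) <= enorm v.
Proof.
case/andP=> a0 a1; apply: ler_wsqrtr; apply: ler_sum => i _; rewrite !mxE mulrACA.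
by rewrite ler_piMl ?mulr_ile1 // -expr2 sqr_ge0.
Qed.

End Enorm.

Section LineDerivatives.
Variable R : realType.

Lemma is_derive_line (V : normedModType R) (w : V -> R) (x v : V) (s l : R) :
  is_derive (x + s *: v) v w l ->
  is_derive s (1 : R) (fun s => w (x + s *: v)) l.
Proof.
move=> [dw <-]; apply: is_derive_cvg.
rewrite (_ : (fun _ => _) = (fun h => h^-1 *: ((w \o shift (x + s *: v)) (h *: v) - w (x + s *: v)))).
  exact: dw.
apply/funext => h /=; congr (_ *: (w _ - _)).
have -> : h *: (1 : R) = h by rewrite /GRing.scale /= mulr1.
by rewrite scalerDl addrCA.
Qed.

Lemma is_derive_coord (V : normedModType R) (N : nat) (g : V -> 'rV[R]_N) (x v : V) a :
  derivable g x v -> is_derive x v (fun y => g y 0 a) ('D_v g x 0 a).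
Proof.
move=> dg; apply: DeriveDef; first exact: ((derivable_mxP g x v).1 dg).
by rewrite (derive_mx dg) mxE.
Qed.

End LineDerivatives.

(** * Chain rule and growth of the potential on the cone *)

Section GradientOnCone.
Variables (R : realType) (N : nat) (F : 'rV[R]_N -> R) (f : 'rV[R]_N -> 'rV[R]_N).
Hypothesis hfF : gradient_on (@coneK R N) F f.

Lemma continuous_gradient_on (T : topologicalType) (U : T -> 'rV[R]_N) :
  continuous U -> (forall z, coneK (U z)) -> continuous (fun z => F (U z)).
Proof.
move=> cU KU z; apply/cvgrPdist_le => e e0.
pose K := enorm (f (U z)) + 1.
have K0 : 0 < K by rewrite ltr_wpDl ?enorm_ge0.
have near1 : \forall y \near z, `|F (U y) - F (U z) - dotv (f (U z)) (U y - U z)|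
    <= 1 * enorm (U y - U z).
  have H : nbhs z (fun y => coneK (U y) ->
    `|F (U y) - F (U z) - dotv (f (U z)) (U y - U z)| <= 1 * enorm (U y - U z)) :=
    cU z _ (hfF (KU z) ltr01).
  by apply: filterS H => y; apply; exact: KU.
have sumc : (\sum_a `|(U y - U z) 0 a|) @[y --> z] --> (0 : R).
  have sum0 : \sum_(a < N) `|(U z - U z) 0 a| = 0.
    by rewrite big1 // => a _; rewrite subrr mxE normr0.
  rewrite -[X in _ --> X]sum0.
  apply: cvg_fsum => a; apply: cvg_norm; under eq_fun do rewrite !mxE; rewrite !mxE.
  apply: cvgB; last exact: cvg_cst.
  exact: (@continuous_comp _ _ _ U (fun M : 'rV[R]_N => M 0 a) z (cU z) (@coord_continuous _ _ _ _ _ _)).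
near=> y.
have h1 : `|F (U y) - F (U z) - dotv (f (U z)) (U y - U z)| <= 1 * enorm (U y - U z).
  by near: y.
have h2 : `|\sum_a `|(U y - U z) 0 a| | <= e / K.
  by near: y; move/cvgr0Pnorm_le: sumc; apply; rewrite divr_gt0.
rewrite distrC -[F (U y) - F (U z)](subrK (dotv (f (U z)) (U y - U z))).
apply: le_trans (ler_normD _ _) _; apply: le_trans (lerD h1 (dotv_le_sum _ _)) _.
apply: (@le_trans _ _ (K * \sum_a `|(U y - U z) 0 a|)).
  by rewrite /K mulrDl addrC lerD2l mul1r mul1r enorm_le_sum.
by rewrite mulrC -ler_pdivlMr // (le_trans (ler_norm _)).
Unshelve. all: by end_near. Qed.

(** [F] is controlled only on the cone, but the whole curve [g] lies in it, so the relative
    expansion of [F] applies at every nearby time. Its remainder, divided by [h], is small because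
    the difference quotients of [g] stay bounded by [B]. *)
Lemma is_derive_gradient_on (g : R -> 'rV[R]_N) (s : R) (dg : 'I_N -> R) :
  (forall s, coneK (g s)) -> (forall a, is_derive s (1 : R) (fun s => g s 0 a) (dg a)) ->
  is_derive s (1 : R) (fun s => F (g s)) (\sum_a f (g s) 0 a * dg a).
Proof.
move=> Kg Dg.
have cg : {for s, continuous g}.
  apply/differentiable_continuous/derivable1_diffP/derivable_mxP => i a.
  by rewrite (ord1 i); exact: (@ex_derive _ _ _ _ _ _ _ (Dg a)).
pose Q a (h : R) := h^-1 * (g (h + s) 0 a - g s 0 a).
have cQ a : Q a h @[h --> 0^'] --> dg a.
  have [dQ <-] := Dg a; have : (fun h : R => h^-1 *: (((fun s => g s 0 a) \o shift s)
     (h *: (1 : R)) - g s 0 a)) @ 0^' --> 'D_1 (fun s => g s 0 a) s := dQ.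
  apply: cvg_trans; apply: near_eq_cvg; near=> h.
  by rewrite /Q /GRing.scale /= mulr1.
pose B := \sum_a `|dg a| + 1.
have B0 : 0 < B by rewrite ltr_wpDl // sumr_ge0.
have cS : (\sum_a `|Q a h|) @[h --> 0^'] --> \sum_a `|dg a|.
  by apply: cvg_fsum => a; exact: cvg_norm.
have cL : (\sum_a f (g s) 0 a * Q a h) @[h --> 0^'] --> \sum_a f (g s) 0 a * dg a.
  by apply: cvg_fsum => a; apply: cvgM => //; exact: cvg_cst.
apply: is_derive_cvg; apply/cvgrPdist_le => e e0.
have e2 : 0 < e / 2 by rewrite divr_gt0.
have e2B : 0 < e / 2 / B by rewrite divr_gt0.
have near1 : \forall h \near (0 : R), `|F (g (h + s)) - F (g s) - dotv (f (g s)) (g (h + s) - g s)|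
    <= e / 2 / B * enorm (g (h + s) - g s).
  have cs : (h + s) @[h --> (0 : R)] --> s.
    by rewrite -[X in _ --> X]add0r; apply: cvgD; [exact: cvg_id|exact: cvg_cst].
  have H : nbhs (0 : R) (fun h => coneK (g (h + s)) ->
    `|F (g (h + s)) - F (g s) - dotv (f (g s)) (g (h + s) - g s)|
      <= e / 2 / B * enorm (g (h + s) - g s)) := cs _ (cg _ (hfF (Kg s) e2B)).
  by apply: filterS H => h; apply; exact: Kg.
near=> h.
have h0 : h != 0 by near: h; exact: nbhs_dnbhs_neq.
have h1 : `|F (g (h + s)) - F (g s) - dotv (f (g s)) (g (h + s) - g s)|
    <= e / 2 / B * enorm (g (h + s) - g s) by near: h; exact: (nbhs_dnbhs near1).
have h2 : `|\sum_a f (g s) 0 a * dg a - \sum_a f (g s) 0 a * Q a h| <= e / 2.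
  by near: h; move/cvgrPdist_le: cL; apply.
have h3 : \sum_a `|Q a h| <= B.
  have : `|\sum_a `|dg a| - \sum_a `|Q a h| | <= 1.
    by near: h; move/cvgrPdist_le: cS; apply.
  by rewrite ler_norml /B => /andP[]; lra.
have gQ a : (g (h + s) - g s) 0 a = h * Q a h.
  by rewrite !mxE /Q mulVKf.
have dQ : dotv (f (g s)) (g (h + s) - g s) = h * \sum_a f (g s) 0 a * Q a h.
  by rewrite mulr_sumr; apply: eq_bigr => a _; rewrite gQ mulrCA.
have eQ : enorm (g (h + s) - g s) <= `|h| * B.
  apply: le_trans (enorm_le_sum _) _.
  under eq_bigr do rewrite gQ normrM; rewrite -mulr_sumr; exact: ler_wpM2l.
rewrite /= {1}/GRing.scale /= [h *: 1]/GRing.scale /= mulr1.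
set S := \sum_a f (g s) 0 a * Q a h in h2 dQ *.
rewrite (_ : _ - h^-1 * _ = (\sum_a f (g s) 0 a * dg a - S)
   - h^-1 * (F (g (h + s)) - F (g s) - dotv (f (g s)) (g (h + s) - g s))); last first.
  by rewrite dQ; field.
rewrite (splitr e); apply: le_trans (ler_normB _ _) _; apply: lerD => //.
rewrite normrM normfV ler_pdivrMl ?normr_gt0 //; apply: le_trans h1 _.
have e20 := ltW e2B; apply: le_trans (ler_wpM2l e20 eQ) _.
by rewrite mulrCA divfK // gt_eqF.
Unshelve. all: by end_near. Qed.

Hypothesis hF0 : F 0 = 0.
Variables (D C q : R).
Hypothesis q0 : 0 <= q.
Hypothesis C0 : 0 <= C.
Hypothesis hC : forall U : 'rV[R]_N, coneK U -> enorm U <= D -> enorm (f U) <= C * enorm U `^ q.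

Lemma powRq1 (x : R) : 0 <= x -> x `^ q * x = x `^ (q + 1).
Proof.
move=> x0; have q1 : 0 < q + 1 by exact: ltr_wpDl.
by rewrite -(mulr_powRB1 x0 q1) addrK mulrC.
Qed.

(* The path [s |-> s^2 U] stays in the cone for all real [s], so the mean value
   theorem applies without one-sided derivatives at the apex. *)
Lemma potential_le (U : 'rV[R]_N) : coneK U -> enorm U <= D ->
  `|F U| <= 2 * N%:R * C * enorm U `^ (q + 1).
Proof.
move=> KU UD.
pose g (s : R) : 'rV[R]_N := s ^+ 2 *: U.
have Kg s : coneK (g s) by move=> a; rewrite mxE mulr_ge0 ?sqr_ge0.
pose dF s := \sum_a f (g s) 0 a * (2 * s * U 0 a).
have DF s : is_derive s (1 : R) (fun s => F (g s)) (dF s).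
  apply: is_derive_gradient_on => // a; rewrite /g.
  under eq_fun do rewrite mxE.
  by apply: is_derive_eq; rewrite /GRing.scale /=; ring.
have cF : {within `[0, 1], continuous (fun s => F (g s))}.
  by apply: derivable_within_continuous => y _; exact: (@ex_derive _ _ _ _ _ _ _ (DF y)).
have [th] := MVT ltr01 (fun x _ => DF x) cF.
rewrite in_itv /= => /andP[th0 th1].
have g1 : g 1 = U by rewrite /g expr1n scale1r.
have g0 : g 0 = 0 by rewrite /g expr0n scale0r.
rewrite g1 g0 hF0 !subr0 mulr1 => ->.
have -> : dF th = 2 * th * dotv (f (g th)) U.
  by rewrite /dF /dotv mulr_sumr; apply: eq_bigr => a _; ring.
have gU : enorm (g th) <= enorm U.
  by apply: ler_enormZ; rewrite sqr_ge0 exprn_ile1 // ltW.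
have fg : enorm (f (g th)) <= C * enorm U `^ q.
  apply: le_trans (hC (Kg th) (le_trans gU UD)) _; apply: ler_wpM2l => //.
  by apply: ge0_ler_powR; rewrite ?nnegrE ?enorm_ge0.
rewrite normrM ger0_norm; last by rewrite mulr_ge0 // ltW.
rewrite -(powRq1 (enorm_ge0 U)).
have e0 := enorm_ge0 U.
have t1 : `|dotv (f (g th)) U| <= N%:R * (C * enorm U `^ q * enorm U).
  apply: le_trans (dotv_le_enorm _ _) _; apply: ler_wpM2l => //.
  exact: ler_wpM2r.
have -> : 2 * N%:R * C * (enorm U `^ q * enorm U) = 2 * (N%:R * (C * enorm U `^ q * enorm U)) by ring.
apply: ler_pM => //; first by rewrite mulr_ge0 // ltW.
by rewrite ler_piMr // ltW.
Qed.

End GradientOnCone.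

(** * Scalar components of a classical solution *)

Section SolutionData.
Variables (R : realType) (n N : nat) (U : 'rV[R]_n * R -> 'rV[R]_N).
Hypothesis hU : C21 U.
Local Notation E := ('rV[R]_n * R)%type.

Lemma continuous_entry (V : E -> 'rV[R]_N) a : continuous V -> continuous (fun z => V z 0 a).
Proof.
by move=> cV z; exact: (@continuous_comp _ _ _ V (fun M : 'rV[R]_N => M 0 a) z (cV z)
  (@coord_continuous _ _ _ _ _ _)).
Qed.

Lemma has_deriv_time a : has_deriv None (fun z => U z 0 a) (fun z => dt U z 0 a).
Proof.
have [cU [dU cdU] _ _ _] := hU; split; [exact: continuous_entry|exact: continuous_entry|].
move=> [x t] s.
have lineE (s' : R) : (x, t) + s' *: dvec R (@None 'I_n) = (x, t + s').
  by congr (_, _) => /=; rewrite ?scaler0 ?addr0 // /GRing.scale /= mulr1.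
rewrite lineE; under eq_fun do rewrite lineE.
have H := @is_derive_line R R (fun t => U (x, t) 0 a) t 1 s (dt U (x, t + s) 0 a).
have e (s' : R) : t + s' *: (1 : R) = t + s' by rewrite /GRing.scale /= mulr1.
rewrite e in H; have {}H := H _; under eq_fun do rewrite -e; apply: H.
by rewrite /dt derive1E; apply: is_derive_coord; exact: dU.
Qed.

(** Stated for a family of slices in order to serve twice: for the slices of [U] and for their first
    derivatives. *)
Lemma has_deriv_space (W : R -> 'rV[R]_n -> 'rV[R]_N) i a :
  continuous (fun z : E => W z.2 z.1) ->
  continuous (fun z : E => partial i (W z.2) z.1) ->
  (forall t x, derivable (W t) x (basis_vec R i)) ->
  has_deriv (Some i) (fun z => W z.2 z.1 0 a) (fun z => partial i (W z.2) z.1 0 a).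
Proof.
move=> cW cdW dW; split; [exact: continuous_entry|exact: continuous_entry|].
move=> [x t] s.
have lineE (s' : R) : (x, t) + s' *: dvec R (Some i) = (x + s' *: basis_vec R i, t).
  by congr (_, _) => /=; rewrite scaler0 addr0.
rewrite lineE; under eq_fun do rewrite lineE /=.
by apply: (@is_derive_line R _ (fun x => W t x 0 a)); apply: is_derive_coord; exact: dW.
Qed.

Lemma has_deriv_grad i a :
  has_deriv (Some i) (fun z => U z 0 a) (fun z => partial i (slice U z.2) z.1 0 a).
Proof.
have [cU _ hCk cg _] := hU.
have UE z : slice U z.2 z.1 = U z by case: z.
have := @has_deriv_space (slice U) i a _ (cg i).
under [X in continuous X -> _]eq_fun do rewrite UE.
under [X in _ -> _ -> has_deriv _ X _]eq_fun do rewrite UE.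
by apply=> // t x; have [_ /(_ i)[dU _]] := hCk t; exact: dU.
Qed.

Lemma has_deriv_hess i a : has_deriv (Some i)
  (fun z => partial i (slice U z.2) z.1 0 a)
  (fun z => partial i (partial i (slice U z.2)) z.1 0 a).
Proof.
have [_ _ hCk cg ch] := hU.
apply: (@has_deriv_space (fun t => partial i (slice U t)) i a (cg i) (ch i i)).
by move=> t x; have [_ /(_ i)[_ [_ /(_ i)[dU _]]]] := hCk t; exact: dU.
Qed.

End SolutionData.

Theorem theorem2p3 (R : realType) (n N : nat) (hn : (1 <= n)%N)
  (hN : (1 <= N)%N) (p q alpha : R)
  (f : 'rV[R]_N -> 'rV[R]_N) (F : 'rV[R]_N -> R)
  (hp1 : 1 < p) (hpsg : (p%:E < p_sg R n)%E)
  (halpha : 0 < alpha)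
  (hF : C1alpha_loc_on (@coneK R N) alpha F)
  (hfF : gradient_on (@coneK R N) F f)
  (hF0 : F 0 = 0)
  (hq : 0 <= q <= p)
  (hpq : q < p - 1 -> p < 1 + 2 / n%:R * (q + 1))
  (hf : forall D : R, 0 < D ->
    exists (C c : R) (xi : 'rV[R]_N),
      [/\ 0 < C, 0 < c, forall i, 0 < xi 0 i
        & forall U : 'rV[R]_N, coneK U -> enorm U <= D ->
            enorm (f U) <= C * enorm U `^ q /\
            c * enorm U `^ p <= dotv xi (f U)])
  (hell : ~ exists U : 'rV[R]_n -> 'rV[R]_N,
    [/\ elliptic_solution f U, bounded_map U, calK U & nontrivial U]) :
  ~ exists U : 'rV[R]_n * R -> 'rV[R]_N,
    [/\ parabolic_solution f U, bounded_map U,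
        forall t, calK (slice U t) & nontrivial U].
Proof.
case=> U [[hU eqU] [M hM] hK [z0 hz0]].
have [cU [dU cdU] hCk cg ch] := hU.
have KU z : coneK (U z) by have [_ /(_ z.1)] := hK z.2; rewrite /slice -surjective_pairing.
pose D := Num.max M 1.
have D0 : 0 < D by rewrite lt_max ltr01 orbT.
have UD z : enorm (U z) <= D by rewrite le_max hM.
have [C [c [xi [C0 c0 xi0 hCc]]]] := hf D D0.
have /andP[q0 qp] := hq.
have feq z a : dt U z 0 a - \sum_i partial i (partial i (slice U z.2)) z.1 0 a = f (U z) 0 a.
  case: z => x t; have /(congr1 (fun v : 'rV[R]_N => v 0 a)) := eqU x t.
  by rewrite !mxE summxE.
have nR : (0 : R) < n%:R by rewrite ltr0n.
have dt0 : forall a z, dt U z 0 a = 0.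
  apply: (@time_derivative_eq0 R n N (fun a z => U z 0 a) (fun a z => dt U z 0 a)
    (fun a i z => partial i (slice U z.2) z.1 0 a)
    (fun a i z => partial i (partial i (slice U z.2)) z.1 0 a)
    (fun z => F (U z)) p q c (2 * N%:R * C) D (fun a => xi 0 a) (fun z => enorm (U z))) => //.
  - by move=> a; exact: has_deriv_time.
  - by move=> a i; exact: has_deriv_grad.
  - by move=> a i; exact: has_deriv_hess.
  - split.
    + exact: (continuous_gradient_on hfF).
    + move=> z; apply: cvg_fsum => a; apply: cvgM; last exact: continuous_entry.
      apply: cvgB; first exact: continuous_entry.
      apply: cvg_fsum => i.
      exact: (@continuous_entry _ _ _ (fun z => partial i (partial i (slice U z.2)) z.1)).
    + move=> z s; under eq_bigr do rewrite feq.
      apply: (is_derive_gradient_on hfF) => // a.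
      by have [_ _] := has_deriv_time hU a; apply.
  - by rewrite !mulr_ge0 // ltW.
  - exact: ltW.
  (* The goal is [n * (p - 1) < 2 * p]. For [n <= 2] it follows from [p > 1]; for [n > 2] it is
     [p * (n - 2) < n] rearranged. *)
  - move: hpsg; rewrite /p_sg; case: ifP => [n2 _|/negbT n2].
      have : (n%:R : R) <= 2 by rewrite ler_nat.
      nra.
    rewrite lte_fin; have : (2 : R) < n%:R by rewrite ltr_nat ltnNge.
    move=> n2'; rewrite ltr_pdivlMr ?subr_gt0 //; nra.
  - move=> /hpq; rewrite -ltrBlDl mulrAC ltr_pdivlMr // mulrC //.
  - by move=> z; rewrite enorm_ge0 UD.
  - by move=> a z; exact: coord_le_enorm.
  - move=> z; under eq_bigr do rewrite feq.
    by have [] := hCc _ (KU z) (UD z).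
  - move=> z; apply: (potential_le hfF hF0 q0 (ltW C0)) (KU z) (UD z).
    by move=> V KV VD; have [] := hCc _ KV VD.
  - move=> z; under eq_bigr do rewrite feq.
    have [h1 _] := hCc _ (KU z) (UD z).
    apply: le_trans (ler_norm _) _; apply: le_trans (dotv_le_enorm _ _) _.
    rewrite -(powRq1 q0 (enorm_ge0 _)).
    have e0 := enorm_ge0 (U z).
    have t1 := ler_wpM2r e0 h1.
    rewrite [enorm (U z) * _]mulrC.
    have N0 : (0 : R) <= N%:R by [].
    apply: le_trans (ler_wpM2l N0 t1) _; rewrite -subr_ge0.
    rewrite (_ : _ - _ = N%:R * (C * (enorm (U z) `^ q * enorm (U z)))); last by ring.
    by repeat apply: mulr_ge0 => //; rewrite ?powR_ge0 // ltW.
(* The slice is taken at the time of a point where [U] does not vanish, so that it is nontrivial. *)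
apply: hell; exists (slice U z0.2); split.
- split=> [|x]; first exact: hCk.
  rewrite -[RHS]/(f (U (x, z0.2))) -eqU.
  rewrite (_ : dt U (x, z0.2) = 0) ?sub0r //.
  by apply/rowP => a; rewrite dt0 mxE.
- by exists M => x; exact: hM.
- exact: hK.
- by exists z0.1; rewrite /slice -surjective_pairing.
Qed.
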